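(* The following polynomials in $\mathbf{k}[z_1,z_2,\dots]$ have the weak interval property: (1) $z^c=\prod_i z_i^{c_i}$ for every quasi-Łukasiewicz vector $c$; (2) $\Delta_+(P)$ for every quasisymmetric polynomial $P(x_1,\dots,x_m)$ (any $m\ge1$); (3) $\Delta_+(\mathfrak{S}_w)$ for every quasi-Łukasiewicz permutation $w$.
   Context: Let $\mathbf{k}$ be a field of characteristic zero and $q\in\mathbf{k}$ not a nontrivial root of unity. The Klyachko algebra $\mathcal{K}$ is the commutative $\mathbf{k}$-algebra generated by $u_i$, $i\in\mathbb{Z}$, with relations $(q+1)u_i^2=qu_iu_{i-1}+u_iu_{i+1}$; $\mathcal{K}_+$ is its quotient by the ideal generated by $u_i$, $i\le0$; it has basis $u_I=\prod_{i\in I}u_i$, $I$ finite subsets of $\mathbb{Z}_{>0}$. $\pi_+:\mathbf{k}[z_1,z_2,\dots]\to\mathcal{K}_+$ sends $z_i\mapsto u_i$. A polynomial $f$ has the weak interval property if every $I$ with nonzero coefficient in the expansion of $\pi_+(f)$ in the basis $\{u_I\}$ is an interval of $\mathbb{Z}$. $\Delta_+:\mathbf{k}[x_1,x_2,\dots]\to\mathbf{k}[z_1,z_2,\dots]$ is the algebra morphism $x_1\mapsto z_1$, $x_i\mapsto z_i-z_{i-1}$ ($i>1$). A nonzero finitely supported $c=(c_1,c_2,\dots)\in\mathbb{N}^{\mathbb{Z}_{>0}}$ is quasi-Łukasiewicz if $\sum_{i=1}^jc_i\ge j$ for all $m_c\le j\le M_c$, where $m_c=\min\{j\ge1:c_j>0,\,c_{j+1}=0\}$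 and $M_c=\max\{j:c_j>0\}$. A permutation $w$ is quasi-Łukasiewicz if for its reduced words $\mathbf{a}$ (equivalently any one of them) the content $\mathrm{cont}(\mathbf{a})$, whose $j$-th entry is the number of occurrences of $j$ in $\mathbf{a}$, is quasi-Łukasiewicz. $\mathfrak{S}_w$ is the Schubert polynomial ($\mathfrak{S}_{w_0}=x_1^{n-1}\cdots x_{n-1}$, $\mathfrak{S}_{ws_i}=\partial_i\mathfrak{S}_w$ when $w(i)>w(i+1)$). *)

(* Defs.v *)
From HB Require Import structures.
From mathcomp Require Import all_boot all_order all_algebra all_fingroup.
From mathcomp Require Import finmap.
From mathcomp.multinomials Require Import monalg.
From mathcomp.multinomials Require Import mpoly.

Set Implicit Arguments.
Unset Strict Implicit.
Unset Printing Implicit Defensive.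

Import GRing.Theory.
Local Open Scope ring_scope.
Local Open Scope fset_scope.

(* The monalg variable number j stands for z_{j+1}.                     *)
Notation ZPoly k := {malg k[{cmonom nat}]}.

(* z_i for i >= 1; by convention zvar 0 = 0 (this is u_0 = 0 in K_+).  *)
Definition zvar (k : fieldType) (i : nat) : ZPoly k :=
  if i is j.+1 then monalg.mkmalgU (monalg.ucm j) 1 else 0.

(* Klyachko relation (q+1) z_i^2 - q z_i z_{i-1} - z_i z_{i+1}, with    *)
(* z_0 = 0 (for i <= 0 the images in K_+ of the relations vanish).       *)
Definition klyachko_rel (k : fieldType) (q : k) (i : nat) : ZPoly k :=
  (q + 1) *: (zvar k i * zvar k i)
  - q *: (zvar k i * zvar k i.-1) - zvar k i * zvar k i.+1.

(* Membership in the ideal J of k[z_1,z_2,...] with K_+ = k[z]/J,       *)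
(* J generated by the Klyachko relations.                                *)
Definition inKideal (k : fieldType) (q : k) (f : ZPoly k) : Prop :=
  exists s : seq (nat * ZPoly k),
    f = \sum_(p <- s) p.2 * klyachko_rel q p.1.

Definition uI (k : fieldType) (I : {fset nat}) : ZPoly k :=
  \prod_(i <- I) zvar k i.

Definition pos_set (I : {fset nat}) : Prop := forall i, i \in I -> (0 < i)%N.

Definition is_interval (I : {fset nat}) : Prop :=
  forall i j l, i \in I -> l \in I -> (i <= j <= l)%N -> j \in I.

(* pi_+(f) = sum_{I in S} a_I u_I holds in K_+ (S a duplicate-free list  *)
(* of finite subsets of Z_{>0}).                                          *)
Definition is_Kexpansion (k : fieldType) (q : k) (f : ZPoly k)
  (S : seq {fset nat}) (a : {fset nat} -> k) : Prop :=
  [/\ uniq S, (forall I, I \in S -> pos_set I) &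
      inKideal q (f - \sum_(I <- S) a I *: uI k I)].

(* Weak interval property: pi_+(f) has an expansion in the basis {u_I}, *)
(* and every u_I occurring with a nonzero coefficient has I an interval. *)
Definition weak_interval (k : fieldType) (q : k) (f : ZPoly k) : Prop :=
  (exists S a, is_Kexpansion q f S a) /\
  (forall S a, is_Kexpansion q f S a ->
     forall I, I \in S -> a I != 0 -> is_interval I).

(* Quasi-Lukasiewicz vectors: c is given as a list, c`_j = c_{j+1}.    *)
Definition cc (c : seq nat) (j : nat) : nat := nth 0%N c j.-1. (* c_j, j >= 1 *)

Definition m_c (c : seq nat) : nat :=
  (find (fun j => (0 < cc c j)%N && (cc c j.+1 == 0%N)) (iota 1 (size c))).+1.

Definition M_c (c : seq nat) : nat :=
  (\max_(j < size c | (0 < nth 0%N c j)%N) j.+1)%N.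

Definition quasiLuk (c : seq nat) : Prop :=
  has (fun x => 0 < x)%N c /\
  forall j, (m_c c <= j <= M_c c)%N -> (j <= \sum_(1 <= i < j.+1) cc c i)%N.

Definition zpow (k : fieldType) (c : seq nat) : ZPoly k :=
  \prod_(j < size c) zvar k j.+1 ^+ nth 0%N c j.

(* Delta_+ on k[x_1,...,x_m] (mpoly variable i stands for x_{i+1}):    *)
(* x_1 |-> z_1, x_i |-> z_i - z_{i-1}.                                  *)
Definition deltaP (k : fieldType) (m : nat) (P : mpoly.mpoly m k) : ZPoly k :=
  mpoly.mmap (fun c : k => c *: (1 : ZPoly k))
             (fun i : 'I_m => zvar k i.+1 - zvar k i) P.

Definition compo (m : nat) (e : mpoly.multinom m) : seq nat :=
  [seq e i | i <- enum 'I_m & e i != 0%N].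

Definition quasisym (k : fieldType) (m : nat) (P : mpoly.mpoly m k) : Prop :=
  forall e e' : mpoly.multinom m,
    compo e = compo e' -> mpoly.mcoeff e P = mpoly.mcoeff e' P.

(* s_j (1 <= j < n) exchanges j and j+1 (0-based ordinals j-1 and j).  *)
Definition s_ (n j : nat) : 'S_n :=
  match n return 'S_n with
  | 0 => 1%g
  | n'.+1 => tperm (@inord n' j.-1) (@inord n' j)
  end.

Definition valid_word (n : nat) (a : seq nat) : bool :=
  all (fun j => 0 < j < n)%N a.

(* w = s_{a_1} o s_{a_2} o ... o s_{a_l} (functional composition;      *)
(* MathComp's product satisfies (s * t) x = t (s x), whence the rev).   *)
Definition word_perm (n : nat) (a : seq nat) : 'S_n :=
  (\prod_(j <- rev a) s_ n j)%g.

Definition reduced_word (n : nat) (w : 'S_n) (a : seq nat) : Prop :=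
  [/\ valid_word n a, w = word_perm n a &
      forall b, valid_word n b -> w = word_perm n b -> (size a <= size b)%N].

Definition content (a : seq nat) : seq nat :=
  [seq count_mem j a | j <- iota 1 (\max_(j <- a) j)%N].

Definition quasiLuk_perm (n : nat) (w : 'S_n) : Prop :=
  exists a, reduced_word w a /\ quasiLuk (content a).

(* Schubert polynomials in k[x_1..x_n], defined by                    *)
(*   S_{w0} = x_1^{n-1} ... x_{n-1},                                   *)
(*   S_{w s_i} = d_i S_w whenever w(i) > w(i+1),                        *)
(* where d_i f = (f - s_i f)/(x_i - x_{i+1}) is written through its     *)
(* defining equation (x_i - x_{i+1}) d_i f = f - s_i f.                 *)
Definition w0 (n : nat) : 'S_n := perm (@rev_ord_inj n).

Definition schubert_family (k : fieldType) (n : nat)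
  (S : 'S_n -> mpoly.mpoly n k) : Prop :=
  S (w0 n) = \prod_(i < n) ('X_i : mpoly.mpoly n k) ^+ (n.-1 - i)
  /\ forall (w : 'S_n) (i : 'I_n) (hi : (i.+1 < n)%N),
       (w (Ordinal hi) < w i)%N ->
       (('X_i : mpoly.mpoly n k) - 'X_(Ordinal hi))
         * S (tperm i (Ordinal hi) * w)%g
       = S w - mpoly.msym (tperm i (Ordinal hi)) (S w).

(* Main.v *)
(* Let balls fall one by one on the sites 1, 2, ...: a ball dropped on a free site stays,
   a ball dropped on an occupied site performs a q-biased random walk until it reaches a
   free site, and it is lost when it reaches 0.  The corresponding operators on the span
   of the finite sets of sites commute and satisfy the Klyachko relations, because the
   outcome is q-harmonic in the starting site on the occupied sites and a finite Dirichlet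
   problem has at most one solution as [n]_q <> 0.  Hence sending a monomial to the
   outcome of its process computes the expansion in the basis u_I.

   (1) Dropping the balls of a quasi-Lukasiewicz monomial from left to right keeps the
   occupied set an interval.
   (2) The image of a monomial quasisymmetric polynomial in x_1, ..., x_m telescopes in m
   to a combination, with coefficients independent of m, of windows containing m.
   (3) A divided difference of f multiplied by u_i compares the values of f at two points
   exchanged by a transposition; summing over i gives [d]_q f = sum_i u_i (d_i f)(p_i) in
   K_+ for f homogeneous of degree d.  Iterating on Schubert polynomials shows that S_w is
   in the span of the words u_a, a reduced for w, and the quasi-Lukasiewicz property does
   not depend on a by Matsumoto's theorem, so (1) applies. *)
Require Import Defs.
From HB Require Import structures.
From mathcomp Require Import all_boot all_order all_algebra all_fingroup.
From mathcomp Require Import finmap.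
From mathcomp.multinomials Require Import monalg.
From mathcomp.multinomials Require Import mpoly.
From mathcomp Require Import ring zify.
Import GRing.Theory.
Set Implicit Arguments.
Unset Strict Implicit.
Unset Printing Implicit Defensive.
Local Open Scope fset_scope.
Local Open Scope ring_scope.

(** * Linear extension and q-integers *)

Section LinearExtension.
Variables (k : fieldType) (K : choiceType) (W : lmodType k).
Implicit Types (F : K -> W) (v : {malg k[K]}).

Definition lext F v : W := \sum_(x <- monalg.msupp v) monalg.mcoeff x v *: F x.

Lemma lextEw F v (d : {fset K}) : monalg.msupp v `<=` d ->
  lext F v = \sum_(x <- d) monalg.mcoeff x v *: F x.
Proof.
move=> le; rewrite /lext (big_fset_incl _ le) //= => x _ /monalg.mcoeff_outdom ->.
by rewrite scale0r.
Qed.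

Lemma lext_linear F : linear (lext F).
Proof.
move=> a v w; pose d := monalg.msupp v `|` monalg.msupp w.
rewrite !(@lextEw F _ d) ?fsubsetUl ?fsubsetUr //; last first.
  apply: fsubset_trans (monalg.msuppD_le _ _) _.
  by apply: fsetUSS; [exact: monalg.msuppZ_le | exact: fsubset_refl].
rewrite scaler_sumr -big_split /=; apply: eq_bigr => x _.
by rewrite monalg.mcoeffD monalg.mcoeffZ scalerDl scalerA.
Qed.

HB.instance Definition _ F :=
  GRing.isLinear.Build k {malg k[K]} W _ (lext F) (lext_linear F).

Lemma lextU F x : lext F (monalg.mkmalgU x 1) = F x.
Proof. by rewrite /lext monalg.msuppU oner_eq0 big_seq_fset1 monalg.mcoeffUU scale1r. Qed.

Lemma malg_sum v : v = \sum_(x <- monalg.msupp v) monalg.mcoeff x v *: monalg.mkmalgU x 1.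
Proof.
rewrite {1}[v]monalg.monalgE; apply: eq_bigr => x _; apply/monalg.malgP => y.
by rewrite monalg.mcoeffZ !monalg.mcoeffU mulrnAr mulr1.
Qed.

End LinearExtension.

Section Submod.
Variables (k : fieldType) (W : lmodType k).

(** Subspaces are predicates, so that one Dirichlet lemma serves both equalities ([v = 0]) and
    congruences modulo the Klyachko ideal. *)
Definition submodP (N : W -> Prop) : Prop :=
  N 0 /\ forall (a : k) v w, N v -> N w -> N (a *: v + w).

Variable N : W -> Prop.
Hypothesis sN : submodP N.

Lemma submod0 : N 0. Proof. by case: sN. Qed.
Lemma submodD v w : N v -> N w -> N (v + w).
Proof. by move=> hv hw; rewrite -[v]scale1r; apply: (proj2 sN). Qed.
Lemma submodZ a v : N v -> N (a *: v).
Proof. by move=> hv; rewrite -[_ *: _]addr0; apply: (proj2 sN) => //; exact: submod0. Qed.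
Lemma submodN v : N v -> N (- v).
Proof. by rewrite -scaleN1r; exact: submodZ. Qed.
Lemma submodB v w : N v -> N w -> N (v - w).
Proof. by move=> hv hw; apply: submodD => //; exact: submodN. Qed.
Lemma submod_sum (I : eqType) (r : seq I) (F : I -> W) :
  (forall i, i \in r -> N (F i)) -> N (\sum_(i <- r) F i).
Proof.
move=> h; rewrite big_seq; elim/big_ind: _ => //; [exact: submod0 | exact: submodD].
Qed.
Lemma submodZE a v : a != 0 -> N (a *: v) -> N v.
Proof. by move=> a0 /(@submodZ a^-1); rewrite scalerA mulVf // scale1r. Qed.
End Submod.

Section Qint.
Variables (k : fieldType) (q : k).

Definition qint (n : nat) : k := \sum_(i < n) q ^+ i.

Lemma qint0 : qint 0 = 0. Proof. by rewrite /qint big_ord0. Qed.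
Lemma qintS n : qint n.+1 = qint n + q ^+ n.
Proof. by rewrite /qint big_ord_recr. Qed.
Lemma qint1 : qint 1 = 1. Proof. by rewrite qintS qint0 add0r expr0. Qed.
Lemma qintSl n : qint n.+1 = 1 + q * qint n.
Proof.
by elim: n => [|n IH]; [rewrite qint1 qint0 mulr0 addr0 | rewrite qintS {1}IH qintS exprS; ring].
Qed.

Hypothesis hchar : [pchar k] =i pred0.
Hypothesis hq : forall N : nat, q ^+ N.+1 = 1 -> q = 1.

(** Since [(q - 1) * qint n.+1 = q ^+ n.+1 - 1], a zero forces [q = 1]; there [qint n.+1] is the
    integer [n + 1], nonzero in characteristic zero. *)
Lemma qint_neq0 n : qint n.+1 != 0.
Proof.
apply/eqP => h.
have q1 : q = 1.
  apply: (hq (N := n)); apply/eqP; rewrite -subr_eq0 subrX1.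
  by rewrite [X in _ * X](_ : _ = 0) ?mulr0.
move: h; rewrite /qint q1; under eq_bigr do rewrite expr1n.
rewrite sumr_const card_ord => /eqP.
by rewrite ((pcharf0P k).1 hchar).
Qed.
End Qint.

(** * The q-harmonic Dirichlet problem *)

(** The search stops at [0] even when [0 \in I]; hence the disjunction in [lft_spec] and the
    separate hypothesis on [F 0] in [dirichlet_unique]. *)
Fixpoint lft (I : {fset nat}) (j : nat) : nat :=
  if j \in I then (if j is j'.+1 then lft I j' else 0%N) else j.

Lemma lft_spec I j : [/\ (lft I j <= j)%N,
  (forall x, (lft I j < x <= j)%N -> x \in I) & lft I j = 0%N \/ lft I j \notin I].
Proof.
elim: j => [|j [IH1 IH2 IH3]] /=.
  by case: ifPn => h; split=> //; [lia | left | lia | left].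
case: ifPn => h; split=> //; last by right.
- exact: leq_trans IH1 _.
- move=> x hx; have [->//|ne] := eqVneq x j.+1.
  by apply: IH2; lia.
- by move=> x; lia.
Qed.

Lemma lft_eq I l j : (l <= j)%N -> l \notin I ->
  (forall x, (l < x <= j)%N -> x \in I) -> lft I j = l.
Proof.
elim: j => [|j IH] /= lj lI h; first by case: ifP => // _; lia.
have [e|ne] := eqVneq l j.+1; first by rewrite -e (negbTE lI).
have -> : j.+1 \in I by apply: h; lia.
by apply: IH => // [|x hx]; [lia | apply: h; lia].
Qed.

Lemma rgt_exists (I : {fset nat}) (j : nat) : exists r, (j <= r)%N && (r \notin I).
Proof.
exists ((\max_(x <- I) x)%N + j)%N.+1; rewrite (leq_trans (leq_addl _ _) (leqnSn _)) /=.
apply/negP => h.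
set x := (X in X \in I) in h.
have : (x <= \max_(y <- I) y)%N by apply: (@leq_bigmax_seq _ (I : seq nat) xpredT id).
by move=> /(leq_ltn_trans (leq_addr _ _)); rewrite ltnn.
Qed.

Definition rgt I j := ex_minn (rgt_exists I j).

Lemma rgt_spec I j : [/\ (j <= rgt I j)%N, rgt I j \notin I &
  forall x, (j <= x < rgt I j)%N -> x \in I].
Proof.
rewrite /rgt; case: ex_minnP => r /andP[jr rI] hmin; split=> // x /andP[jx xr].
by apply: contraLR xr => xI; rewrite -leqNgt hmin // jx.
Qed.

Lemma rgt_eq I r j : (j <= r)%N -> r \notin I ->
  (forall x, (j <= x < r)%N -> x \in I) -> rgt I j = r.
Proof.
have [h1 h2 h3] := rgt_spec I j => jr rI h.
apply/eqP; rewrite eqn_leq; apply/andP; split; rewrite leqNgt; apply/negP => lt.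
  by move: rI; rewrite h3 // jr.
by move: h2; rewrite h // h1.
Qed.

Section Dirichlet.
Variables (k : fieldType) (q : k).
Hypothesis hchar : [pchar k] =i pred0.
Hypothesis hq : forall N : nat, q ^+ N.+1 = 1 -> q = 1.

(* Along an interval of I the increments of a q-harmonic function form a geometric
   progression of ratio q, so the two boundary values determine it because [n]_q <> 0. *)
Lemma dirichlet_unique (W : lmodType k) (N : W -> Prop) (F : nat -> W) (I : {fset nat}) :
  submodP N -> N (F 0%N) -> (forall j, j \notin I -> N (F j)) ->
  (forall j, j.+1 \in I -> N ((q + 1) *: F j.+1 - q *: F j - F j.+2)) ->
  forall j, N (F j).
Proof.
move=> sN F0 Fout Fharm j.
have [lj lI ll] := lft_spec I j; have [jr rI rr] := rgt_spec I j.
set l := lft I j in lj lI ll; set r := rgt I j in jr rI rr.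
have Nl : N (F l) by case: ll => [->|] //; apply: Fout.
have Nr : N (F r) by apply: Fout.
pose d t := F (l + t).+1 - F (l + t)%N.
have dS t : (l + t.+1 < r)%N -> N (q *: d t - d t.+1).
  move=> ht; rewrite /d addnS.
  have hI : (l + t).+1 \in I.
    by have [h|h] := leqP (l + t).+1 j; [apply: lI | apply: rr]; lia.
  congr N: (Fharm _ hI).
  by rewrite scalerDl scale1r scalerBr opprB !addrA; congr (_ - _); rewrite addrAC.
have key t : (l + t < r)%N -> N (d t - q ^+ t *: d 0%N).
  elim: t => [|t IH] ht; first by rewrite expr0 scale1r subrr; apply: submod0 sN.
  have /(submodZ sN q) h1 : N (d t - q ^+ t *: d 0%N) by apply: IH; lia.
  have h2 := submodB sN h1 (dS _ ht); congr N: h2.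
  by rewrite scalerBr scalerA -exprS opprB addrC addrA subrK.
have F_qint t : (l + t <= r)%N -> N (F (l + t)%N - qint q t *: d 0%N).
  elim: t => [|t IH] ht; first by rewrite addn0 qint0 scale0r subr0.
  have h1 := submodD sN (IH (ltnW (eq_ind _ (fun n => (n <= r)%N) ht _ (addnS l t)))) (key t (eq_ind _ (fun n => (n <= r)%N) ht _ (addnS l t))).
  congr N: h1; rewrite addnS qintS scalerDl /d opprD addrACA; congr (_ + _).
  by rewrite addrC subrK.
have [lr|lr] := leqP r l.
  by have -> : j = l by lia.
(* [F r] and [F r - qint q (r - l) *: d 0] both lie in [N], and [r - l] is positive, so the
   q-integer can be cancelled. *)
have Nd : N (d 0%N).
  have e : r = (l + (r - l).-1.+1)%N by lia.
  have /(submodB sN Nr) : N (F r - qint q (r - l).-1.+1 *: d 0%N).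
    by rewrite {1}e; apply: F_qint; lia.
  rewrite opprB addrC subrK; apply: submodZE => //.
  exact: qint_neq0.
have := F_qint (j - l)%N; rewrite subnKC // => /(_ jr) h.
by have := submodD sN h (submodZ sN (qint q (j - l)) Nd); rewrite subrK.
Qed.
End Dirichlet.

(** * Ball-dropping operators and the expansion in K_+ *)

Lemma affine_harmonic (k : fieldType) (W : lmodType k) (a d : W) (q x y z c : k) :
  (q + 1) * y = q * x + z ->
  (q + 1) *: (a + (y / c) *: d) = q *: (a + (x / c) *: d) + (a + (z / c) *: d).
Proof.
move=> e; rewrite !scalerDr !scalerA addrACA -[in RHS](scale1r a) scalerA mulr1.
by rewrite -!scalerDl !mulrA e mulrDl.
Qed.

Lemma harmonicB (k : fieldType) (W : lmodType k) (q : k) (x y z x' y' z' : W) :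
  (q + 1) *: y = q *: x + z -> (q + 1) *: y' = q *: x' + z' ->
  (q + 1) *: (y - y') - q *: (x - x') - (z - z') = 0.
Proof.
move=> e e'; rewrite !scalerBr e e' [- (_ + z')]opprD addrACA; set u := q *: x - _; set v := z - _.
by rewrite addrAC addrK subrr.
Qed.

Lemma harmonicB_r (k : fieldType) (W : lmodType k) (q : k) (x y z x' y' z' : W) :
  (q + 1) *: y' = q *: x' + z' ->
  (q + 1) *: (y - y') - q *: (x - x') - (z - z') = (q + 1) *: y - q *: x - z.
Proof.
have sub2 (a a' b b' : W) : (a - a') - (b - b') = (a - b) - (a' - b').
  by rewrite [in LHS]opprD addrACA -opprD.
by move=> e; rewrite !scalerBr (sub2 _ _ (q *: x)) (sub2 (_ - _) _ z) e [q *: x' + z' - _]addrC addKr subrr subr0.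
Qed.

Lemma klyachko_factor (k : fieldType) (A : comAlgType k) (q : k) (a b c g : A) :
  (q + 1) *: (b * (b * g)) - q *: (a * (b * g)) - c * (b * g) =
  g * ((q + 1) *: (b * b) - q *: (b * a) - b * c).
Proof. by rewrite -mulr_algl -[q *: _]mulr_algl -[in RHS]mulr_algl -[in RHS](mulr_algl q); ring. Qed.

(* Named so that unification does not unfold the module structure of malg. *)
Definition vsets (k : fieldType) : lmodType k := {malg k[{fset nat}]}.

Section Operators.
Variables (k : fieldType) (q : k).
Local Notation V := (vsets k).
Implicit Types (I J : {fset nat}) (v : V).

(** Sets containing [0] are sent to zero: this encodes [u_0 = 0], the loss of a ball that reaches
    [0]. *)
Definition basisv I : V := if 0%N \in I then 0 else monalg.mkmalgU I 1.

(** Gambler's ruin: from [j] the walk leaves the occupied run at [r] rather than at [l] with weight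
    [qint (j - l) / qint (r - l)]. If [j] is free, then [l = r = j], the quotient is [0 / 0 = 0],
    and the ball stays at [j]. *)
Definition drop_basis (j : nat) I : V :=
  let l := lft I j in let r := rgt I j in
  basisv (l |` I) + (qint q (j - l) / qint q (r - l)) *: (basisv (r |` I) - basisv (l |` I)).

Definition drop (j : nat) : V -> V := lext (drop_basis j).

Lemma drop_linear j : linear (drop j).
Proof. exact: lext_linear. Qed.
HB.instance Definition _ j := GRing.isLinear.Build k V V _ (drop j) (drop_linear j).

Lemma dropZ j a v : drop j (a *: v) = a *: drop j v. Proof. exact: linearZ. Qed.
Lemma dropD j v w : drop j (v + w) = drop j v + drop j w. Proof. exact: linearD. Qed.
Lemma dropv0 j : drop j 0 = 0. Proof. exact: linear0. Qed.
Lemma drop_sum j (T : Type) (r : seq T) (F : T -> V) :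
  drop j (\sum_(i <- r) F i) = \sum_(i <- r) drop j (F i).
Proof. exact: linear_sum. Qed.

Definition supported (P : {fset nat} -> Prop) v := forall I, I \in monalg.msupp v -> P I.

Lemma supported_submod P : submodP (supported P).
Proof.
split=> [I|a v w hv hw I]; first by rewrite monalg.msupp0 in_fset0.
move/(fsubsetP (monalg.msuppD_le _ _)); rewrite in_fsetU => /orP[|]; last exact: hw.
by move/(fsubsetP (monalg.msuppZ_le _ _)); exact: hv.
Qed.

Lemma supported_basisv P I : (0%N \notin I -> P I) -> supported P (basisv I).
Proof.
rewrite /basisv => h J; case: ifPn => hI; first by rewrite monalg.msupp0 in_fset0.
by rewrite monalg.msuppU oner_eq0 in_fset1 => /eqP ->; exact: h.
Qed.

Lemma lext_submod (W : lmodType k) (N : W -> Prop) (P : {fset nat} -> Prop)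
  (F : {fset nat} -> W) v :
  submodP N -> supported P v -> (forall I, P I -> N (F I)) -> N (lext F v).
Proof.
move=> sN sv h; rewrite /lext; apply: (submod_sum sN) => I hI.
by apply: (submodZ sN); apply: h; apply: sv.
Qed.

Lemma drop_basisv j I : drop j (basisv I) = drop_basis j I.
Proof.
rewrite /basisv; case: ifPn => h; last by rewrite /drop lextU.
by rewrite dropv0 /drop_basis /basisv !in_fsetU h !orbT subrr scaler0 addr0.
Qed.

Lemma drop_supported (P Q : {fset nat} -> Prop) j v :
  (forall I, P I -> supported Q (drop_basis j I)) -> supported P v ->
  supported Q (drop j v).
Proof. by move=> h sv; apply: (lext_submod (supported_submod Q) sv). Qed.

Lemma drop_basis_supported j I : supported (fun J => exists x,
    [/\ x \notin I, J = x |` I, 0%N \notin J &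
     ((x <= j)%N /\ forall y, (x < y <= j)%N -> y \in I) \/
     ((j <= x)%N /\ forall y, (j <= y < x)%N -> y \in I)]) (drop_basis j I).
Proof.
set P := fun _ => _.
have sP := supported_submod P.
have [lj lI ll] := lft_spec I j; have [jr rI rr] := rgt_spec I j.
have Pl : supported P (basisv (lft I j |` I)).
  apply: supported_basisv => h; exists (lft I j); split=> //; last by left.
  (* If the search stopped at [0], the new set contains [0], which [h] excludes. *)
  by case: ll => // e; move: h; rewrite in_fsetU e in_fset1.
have Pr : supported P (basisv (rgt I j |` I)).
  by apply: supported_basisv => h; exists (rgt I j); split=> //; right.
by apply: (submodD sP) => //; apply: (submodZ sP); apply: (submodB sP).
Qed.

Hypothesis hchar : [pchar k] =i pred0.
Hypothesis hq : forall N : nat, q ^+ N.+1 = 1 -> q = 1.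

(** Gives one formula on the whole closed range [l <= j <= r], including the free ends, where the
    definition itself takes [l = r = j]. Neighbouring values of [j] can then be compared. *)
Lemma drop_basisE l r j I : (l <= j <= r)%N -> l \notin I -> r \notin I -> (l < r)%N ->
  (forall x, (l < x < r)%N -> x \in I) ->
  drop_basis j I = basisv (l |` I)
    + (qint q (j - l) / qint q (r - l)) *: (basisv (r |` I) - basisv (l |` I)).
Proof.
move=> /andP[lj jr] lI rI lr h; rewrite /drop_basis.
have [e|nl] := eqVneq j l.
  have -> : lft I j = l by rewrite e; apply: lft_eq; rewrite ?leqnn //; move=> x; lia.
  by rewrite e subnn qint0 2!mul0r [X in _ + X = _]scale0r [X in _ = _ + X]scale0r.
have [e|nr] := eqVneq j r.
  have -> : rgt I j = r by rewrite e; apply: rgt_eq => //; rewrite ?leqnn //; move=> x; lia.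
  have -> : lft I j = r by rewrite e; apply: lft_eq; rewrite ?leqnn //; move=> x; lia.
  rewrite e subnn qint0 mul0r [X in _ + X = _]scale0r divff.
    by rewrite addr0 scale1r addrC subrK.
  have -> : (r - l)%N = (r - l).-1.+1 by lia.
  exact: qint_neq0.
have -> : lft I j = l by apply: lft_eq => // x hx; apply: h; lia.
have -> // : rgt I j = r by apply: rgt_eq => // x hx; apply: h; lia.
Qed.

Lemma drop_basis_out j I : j \notin I -> drop_basis j I = basisv (j |` I).
Proof.
move=> h; have e : lft I j = j by apply: lft_eq; rewrite ?leqnn //; move=> x; lia.
by rewrite /drop_basis e subnn qint0 mul0r [X in _ + X]scale0r addr0.
Qed.

Lemma drop_basis_in0 j I : 0%N \in I -> drop_basis j I = 0.
Proof.
by move=> h; rewrite /drop_basis /basisv !in_fsetU h !orbT subrr scaler0 addr0.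
Qed.

(** With common ends for [j], [j.+1] and [j.+2], this is the q-harmonicity of the q-integers. *)
Lemma drop_basis_harmonic j I : j.+1 \in I ->
  (q + 1) *: drop_basis j.+1 I = q *: drop_basis j I + drop_basis j.+2 I.
Proof.
move=> jI; have [h0|h0] := boolP (0%N \in I).
  by rewrite !drop_basis_in0 // !scaler0 addr0.
have [lj lI ll] := lft_spec I j.+1; have [jr rI rr] := rgt_spec I j.+1.
set l := lft I j.+1 in lj lI ll; set r := rgt I j.+1 in jr rI rr.
have {}ll : l \notin I by case: ll => [->|].
have lr : (l < r)%N.
  rewrite ltn_neqAle (leq_trans lj jr) andbT; apply/eqP => e.
  have e' : r = j.+1 by lia.
  by rewrite e' jI in rI.
have lj' : (l < j.+1)%N.
  by rewrite ltn_neqAle lj andbT; apply: contraNneq ll => ->.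
have jr' : (j.+1 < r)%N.
  by rewrite ltn_neqAle jr andbT; apply: contraNneq rI => <-.
have hI x : (l < x < r)%N -> x \in I.
  by move=> hx; have [h|h] := leqP x j.+1; [apply: lI | apply: rr]; lia.
rewrite !(@drop_basisE l r) //; try lia.
have -> : (j.+2 - l)%N = (j - l).+2 by lia.
have -> : (j.+1 - l)%N = (j - l).+1 by lia.
apply: affine_harmonic; rewrite !qintSl; ring.
Qed.

Lemma drop_harmonic j v : supported (fun I => j.+1 \in I) v ->
  (q + 1) *: drop j.+1 v = q *: drop j v + drop j.+2 v.
Proof.
move=> sv; rewrite /drop /lext !scaler_sumr -big_split /= !big_seq.
apply: eq_bigr => I /sv hI.
by rewrite !scalerA ![_ * monalg.mcoeff _ _]mulrC -!scalerA -scalerDr drop_basis_harmonic.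
Qed.

Lemma drop_basis_mono j I : supported (fun J => I `<=` J) (drop_basis j I).
Proof. by move=> J /drop_basis_supported[x [_ -> _ _]]; exact: fsubsetU1. Qed.

Lemma supported_mem_drop j v : supported (fun I => j \in I) (drop j v).
Proof.
apply: (@drop_supported (fun=> True)) => // I _.
have [h|h] := boolP (j \in I).
  by move=> J /drop_basis_mono /fsubsetP; exact.
by rewrite drop_basis_out //; apply: supported_basisv; rewrite fset1U1.
Qed.

(* The commutator is q-harmonic in each index on I, so Dirichlet uniqueness in both
   indices reduces commutation to the trivial case i, j \notin I. *)
Lemma drop_comm_basis i j I :
  drop i (drop_basis j I) = drop j (drop_basis i I).
Proof.
have sub0 : @submodP k V (fun v => v = 0).
  by split=> // a v w -> ->; rewrite scaler0 addr0.
pose G i j := drop i (drop_basis j I) - drop j (drop_basis i I).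
have Gharm i' j' : j'.+1 \in I ->
    (q + 1) *: G i' j'.+1 - q *: G i' j' - G i' j'.+2 = 0.
  move=> hI; apply: harmonicB.
    by rewrite -dropZ drop_basis_harmonic // dropD dropZ.
  by apply: drop_harmonic => J /drop_basis_mono /fsubsetP; exact.
have GN : forall x y, G x y = - G y x by move=> x y; rewrite /G opprB.
have Gout : forall i' j', i' \notin I -> j' \notin I -> G i' j' = 0.
  move=> i' j' hi hj; rewrite /G !drop_basis_out // !drop_basisv.
  have [->|ne] := eqVneq i' j'; first by rewrite subrr.
  rewrite (@drop_basis_out i') ?in_fset1U ?negb_or ?ne //.
  by rewrite drop_basis_out ?in_fset1U ?negb_or 1?eq_sym ?ne // fsetUCA subrr.
(* First use of uniqueness: in the second index, with the first index free. *)
have G0 : forall i' j', i' \notin I -> G i' j' = 0.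
  move=> i' j' hi; apply: (dirichlet_unique hchar hq (F := G i') (I := I) sub0) => //.
  - have [h0|h0] := boolP (0%N \in I); last exact: Gout.
    by rewrite /G !drop_basis_in0 // !dropv0 subr0.
  - by move=> j'' hj; apply: Gout.
  - by move=> j'' hj; exact: Gharm.
(* Second use, for arbitrary [i]: antisymmetry turns [G0] into the boundary values. *)
apply/eqP; rewrite -subr_eq0; apply/eqP.
apply: (dirichlet_unique hchar hq (F := G i) (I := I) sub0) => //.
- have [h0|h0] := boolP (0%N \in I).
    by rewrite /G !drop_basis_in0 // !dropv0 subr0.
  by rewrite GN G0 // oppr0.
- by move=> j' hj; rewrite GN G0 // oppr0.
- by move=> j' hj; exact: Gharm.
Qed.

Lemma drop_comm i j v : drop i (drop j v) = drop j (drop i v).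
Proof.
rewrite [drop j v]/drop [drop i v]/drop /lext !drop_sum; apply: eq_bigr => I _.
by rewrite !dropZ drop_comm_basis.
Qed.

(** Every set occurring in [drop j.+1 v] contains [j.+1], so [drop_harmonic] applies there;
    commutation restores the order of the operators. *)
Lemma drop_klyachko j v :
  (q + 1) *: drop j.+1 (drop j.+1 v) = q *: drop j.+1 (drop j v) + drop j.+1 (drop j.+2 v).
Proof.
rewrite drop_harmonic; last exact: supported_mem_drop.
by rewrite [drop j _]drop_comm [drop j.+2 _]drop_comm.
Qed.

Lemma drop0 v : drop 0 v = 0.
Proof.
rewrite /drop /lext big1 // => I _.
have [h|h] := boolP (0%N \in I); first by rewrite drop_basis_in0 // scaler0.
by rewrite drop_basis_out // /basisv fset1U1 scaler0.
Qed.

Definition drop_word (a : seq nat) (v : V) : V := foldr drop v a.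

Lemma drop_word_linear a : linear (drop_word a).
Proof.
move=> c v w; elim: a => [|j a IH]; first by [].
by rewrite /= IH dropD dropZ.
Qed.
HB.instance Definition _ a := GRing.isLinear.Build k V V _ (drop_word a) (drop_word_linear a).

Lemma drop_word_cat a b v : drop_word (a ++ b) v = drop_word a (drop_word b v).
Proof. exact: foldr_cat. Qed.

Lemma drop_drop_word j a v : drop j (drop_word a v) = drop_word a (drop j v).
Proof. by elim: a => [|i a IH]; [ | rewrite /= drop_comm IH]. Qed.

Lemma drop_word_perm a b v : perm_eq a b -> drop_word a v = drop_word b v.
Proof.
elim: a b => [|j a IH] b; first by rewrite perm_sym => /perm_nilP ->.
move=> h; have jb : j \in b by rewrite -(perm_mem h) mem_head.
case/splitPr: jb h => b1 b2; rewrite perm_sym perm_catC /= perm_cons perm_catC perm_sym => h.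
by rewrite /= (IH _ h) !drop_word_cat /= drop_drop_word.
Qed.

(** * Straightening polynomials by dropping balls *)

Definition monom_word (m : {cmonom nat}) : seq nat :=
  flatten [seq nseq (m i) i.+1 | i <- finsupp m].

Lemma count_monom_word (m : {cmonom nat}) j : count_mem j.+1 (monom_word m) = m j.
Proof.
rewrite /monom_word count_flatten -map_comp sumnE big_map /=.
under eq_bigr do rewrite count_nseq /= eqSS.
have [h|h] := boolP (j \in finsupp m).
  rewrite (big_fsetD1 j) //= eqxx mul1n big1_fset ?addn0 // => i.
  by rewrite in_fsetD1 => /andP[/negbTE -> _].
rewrite big_seq big1 => [|i hi]; first by rewrite fsfun_dflt.
by have [e|] := eqVneq i j; [rewrite e (negbTE h) in hi | rewrite mul0n].
Qed.

Lemma count_monom_word0 (m : {cmonom nat}) : count_mem 0%N (monom_word m) = 0%N.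
Proof.
rewrite /monom_word count_flatten -map_comp sumnE big_map /= big1 // => i _.
by rewrite count_nseq.
Qed.

Lemma monom_word_mulU j m :
  perm_eq (monom_word (mmul (monalg.ucm j) m)) (j.+1 :: monom_word m).
Proof.
apply/allP => -[|i] _ /=; first by rewrite !count_monom_word0.
by rewrite !count_monom_word monalg.cmM monalg.cmU eqSS.
Qed.

Lemma monomM (m m' : {cmonom nat}) :
  monalg.mkmalgU m 1 * monalg.mkmalgU m' 1 = monalg.mkmalgU (mmul m m') 1 :> ZPoly k.
Proof. by have := monalg.fgmulUU (1 : k) 1 m m'; rewrite mulr1. Qed.

Lemma zvar_monom j (m : {cmonom nat}) :
  zvar k j.+1 * monalg.mkmalgU m 1 = monalg.mkmalgU (mmul (monalg.ucm j) m) 1.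
Proof. exact: monomM. Qed.

Definition straighten : ZPoly k -> V :=
  lext (fun m => drop_word (monom_word m) (basisv fset0)).

Lemma straighten_linear : linear straighten.
Proof. exact: lext_linear. Qed.
HB.instance Definition _ := GRing.isLinear.Build k (ZPoly k) V _ (straighten) straighten_linear.

Lemma straightenZ a f : straighten (a *: f) = a *: straighten f. Proof. exact: linearZ. Qed.
Lemma straightenD f g : straighten (f + g) = straighten f + straighten g. Proof. exact: linearD. Qed.
Lemma straightenB f g : straighten (f - g) = straighten f - straighten g. Proof. exact: linearB. Qed.
Lemma straighten0 : straighten 0 = 0. Proof. exact: linear0. Qed.
Lemma straighten_sum (T : Type) (r : seq T) (F : T -> (ZPoly k)) :
  straighten (\sum_(i <- r) F i) = \sum_(i <- r) straighten (F i).
Proof. exact: linear_sum. Qed.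

(** [monom_word] fixes some order of the balls; since the operators commute, the additional ball may
    be taken to fall last. *)
Lemma straighten_zvar j f : straighten (zvar k j * f) = drop j (straighten f).
Proof.
case: j => [|j]; first by rewrite mul0r straighten0 drop0.
rewrite [in LHS](malg_sum f) mulr_sumr [in LHS]straighten_sum.
rewrite [in RHS](malg_sum f) [in RHS]straighten_sum drop_sum; apply: eq_bigr => m _.
rewrite -scalerAr [in LHS]straightenZ [in RHS]straightenZ dropZ; congr (_ *: _).
rewrite zvar_monom [LHS]lextU /straighten lextU.
by rewrite (drop_word_perm _ (monom_word_mulU j m)).
Qed.

Lemma straighten1 : straighten 1 = basisv fset0.
Proof.
rewrite [LHS]lextU /monom_word monalg.mdom1.
by have -> : (fset0 : {fset nat}) = [::] :> seq nat by apply: size0nil; rewrite cardfs0.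
Qed.

Lemma monomU_word (m : {cmonom nat}) :
  monalg.mkmalgU m 1 = \prod_(j <- monom_word m) zvar k j :> ZPoly k.
Proof.
have pos : all (leq 1) (monom_word m).
  by apply/allP => x /flatten_mapP[i _]; rewrite mem_nseq => /andP[_ /eqP ->].
pose mon (a : seq nat) : {cmonom nat} := foldr (fun j => mmul (monalg.ucm j.-1)) mone a.
have prodE a : all (leq 1) a -> \prod_(j <- a) zvar k j = monalg.mkmalgU (mon a) 1.
  elim: a => [_|[|j] a IH ha]; [by rewrite big_nil | by [] | ].
  by rewrite big_cons IH // [LHS]zvar_monom.
have monE : mon (monom_word m) = m; last by rewrite (prodE _ pos) monE.
apply/eqP/monalg.cmP => i; rewrite -[RHS]count_monom_word.
elim: (monom_word m) pos => [|[|j] a IH] //=; first by rewrite monalg.cm1.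
by move=> ha; rewrite monalg.cmM monalg.cmU IH.
Qed.

Lemma straighten_word a f :
  straighten ((\prod_(j <- a) zvar k j) * f) = drop_word a (straighten f).
Proof.
elim: a => [|j a IH]; first by rewrite big_nil mul1r.
by rewrite big_cons -mulrA straighten_zvar IH.
Qed.

Lemma straighten_ideal f g : straighten f = 0 -> straighten (g * f) = 0.
Proof.
move=> h; rewrite (malg_sum g). rewrite mulr_suml. rewrite [LHS]straighten_sum. apply: big1 => m _.
by rewrite -scalerAl straightenZ monomU_word straighten_word h [drop_word _ _]linear0 scaler0.
Qed.

Lemma straighten_zvar2 i j :
  straighten (zvar k i * zvar k j) = drop i (drop j (basisv fset0)).
Proof. by rewrite straighten_zvar -[zvar k j]mulr1 straighten_zvar straighten1. Qed.

Lemma straighten_klyachko i : straighten (klyachko_rel q i) = 0.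
Proof.
rewrite /klyachko_rel; case: i => [|i].
  by rewrite !mul0r !scaler0 !subr0 straighten0.
rewrite [LHS]straightenB. rewrite [X in X - _]straightenB. rewrite [X in X - _ - _]straightenZ.
rewrite [X in _ - X - _]straightenZ. rewrite [X in _ *: X - _ - _]straighten_zvar2. rewrite [X in _ - _ *: X - _]straighten_zvar2. rewrite [X in _ - _ - X]straighten_zvar2. rewrite drop_klyachko.
by rewrite addrAC addrK subrr.
Qed.

Lemma straighten_inKideal f : inKideal q f -> straighten f = 0.
Proof.
case=> s ->; rewrite straighten_sum big1_seq // => p _.
exact/straighten_ideal/straighten_klyachko.
Qed.

Lemma uI_fset1U j I : j \notin I -> uI k (j |` I) = zvar k j * uI k I.
Proof. by move=> h; rewrite /uI big_fsetU1. Qed.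

(** Together with [straighten_inKideal] this gives the linear independence in [K_+] of the [u_I]
    with [I] a set of positive integers. *)
Lemma straighten_uI I : straighten (uI k I) = basisv I.
Proof.
elim: {I}_.+1 {-2}I (ltnSn #|` I|) => // n IH I hI.
have [->|/fset0Pn[x xI]] := eqVneq I fset0; first by rewrite /uI big_seq_fset0 straighten1.
rewrite -(fsetD1K xI) uI_fset1U ?in_fsetD1 ?eqxx // straighten_zvar IH.
  by rewrite drop_basisv drop_basis_out // in_fsetD1 eqxx.
by move: hI; rewrite (cardfsD1 x) xI; lia.
Qed.

(** * Spanning of the quotient by the products [u_I] *)

Lemma inKideal_submod : submodP (inKideal (k := k) q).
Proof.
split; first by exists [::]; rewrite big_nil.
move=> a _ _ [s ->] [t ->].
exists ([seq (p.1, a *: p.2) | p <- s] ++ t).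
rewrite big_cat big_map /= scaler_sumr; congr (_ + _).
by apply: eq_bigr => p _; rewrite scalerAl.
Qed.

Lemma inKidealM f g : inKideal q f -> inKideal q (g * f).
Proof.
case=> s ->; exists [seq (p.1, g * p.2) | p <- s].
by rewrite big_map mulr_sumr; apply: eq_bigr => p _; rewrite mulrA.
Qed.

Lemma inKideal_rel i : inKideal q (klyachko_rel q i : ZPoly k).
Proof. by exists [:: (i, 1)]; rewrite big_seq1 mul1r. Qed.

Definition uspan : V -> ZPoly k := lext (uI k).

Lemma uspan_linear : linear uspan.
Proof. exact: lext_linear. Qed.
HB.instance Definition _ := GRing.isLinear.Build k V (ZPoly k) _ (uspan) uspan_linear.

Lemma uspanZ a f : uspan (a *: f) = a *: uspan f. Proof. exact: linearZ. Qed.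
Lemma uspanD f g : uspan (f + g) = uspan f + uspan g. Proof. exact: linearD. Qed.
Lemma uspan0 : uspan 0 = 0. Proof. exact: linear0. Qed.
Lemma uspan_sum (T : Type) (r : seq T) (F : T -> V) :
  uspan (\sum_(i <- r) F i) = \sum_(i <- r) uspan (F i).
Proof. exact: linear_sum. Qed.

Lemma uspan_basisv I : uspan (basisv I) = uI k I.
Proof.
rewrite /basisv; case: ifPn => h; last by rewrite /uspan lextU.
by rewrite uspan0 /uI (big_fsetD1 0%N) //= mul0r.
Qed.

(** As a function of [j], the difference is q-harmonic on [I] modulo the ideal and vanishes at free
    sites; Dirichlet uniqueness modulo the ideal concludes. *)
Lemma zvar_uI j I : inKideal q (zvar k j * uI k I - uspan (drop_basis j I)).
Proof.
pose F j := zvar k j * uI k I - uspan (drop_basis j I).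
have Fout j' : j' \notin I -> inKideal q (F j').
  move=> h; rewrite /F drop_basis_out // uspan_basisv uI_fset1U // subrr.
  exact: submod0 inKideal_submod.
apply: (dirichlet_unique hchar hq (F := F) (I := I) inKideal_submod) => //.
  have [h0|h0] := boolP (0%N \in I); last exact: Fout.
  rewrite /F drop_basis_in0 // uspan0 mul0r subrr.
  exact: submod0 inKideal_submod.
move=> j' hj'; rewrite /F.
(* The factor [z_(j'+1)] taken out of [u_I] turns the harmonic defect into a multiple of a Klyachko
   relation. *)
have -> : uI k I = zvar k j'.+1 * uI k (I `\ j'.+1).
  by rewrite -uI_fset1U ?fsetD1K // in_fsetD1 eqxx.
set g := uI k _.
have -> : (q + 1) *: (zvar k j'.+1 * (zvar k j'.+1 * g) - uspan (drop_basis j'.+1 I))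
  - q *: (zvar k j' * (zvar k j'.+1 * g) - uspan (drop_basis j' I))
  - (zvar k j'.+2 * (zvar k j'.+1 * g) - uspan (drop_basis j'.+2 I))
  = g * klyachko_rel q j'.+1; last exact/inKidealM/inKideal_rel.
rewrite (@harmonicB_r _ (ZPoly k)); first exact: klyachko_factor.
by rewrite -uspanZ drop_basis_harmonic // uspanD uspanZ.
Qed.

Lemma zvar_uspan j v : inKideal q (zvar k j * uspan v - uspan (drop j v)).
Proof.
rewrite (malg_sum v) drop_sum [X in _ * X - _]uspan_sum [X in _ - X]uspan_sum mulr_sumr -sumrB.
apply: (submod_sum inKideal_submod) => I _.
rewrite dropZ [X in _ * X - _]uspanZ [X in _ - X]uspanZ -scalerAr -scalerBr; apply: (submodZ inKideal_submod).
by rewrite /drop /uspan !lextU; exact: zvar_uI.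
Qed.

(** This is the spanning half of the basis property; it provides the existence of an expansion in
    [weak_interval]. *)
Lemma straightenK f : inKideal q (f - uspan (straighten f)).
Proof.
have sJ := inKideal_submod.
rewrite [f]malg_sum straighten_sum uspan_sum -sumrB; apply: (submod_sum sJ) => m _.
rewrite straightenZ uspanZ -scalerBr; apply: (submodZ sJ).
rewrite monomU_word -[\prod_(j <- _) _]mulr1 straighten_word straighten1 mulr1.
elim: (monom_word m) => [|j a IH].
  by rewrite big_nil /= uspan_basisv /uI big_seq_fset0 subrr; exact: submod0 sJ.
rewrite big_cons /=; have h := submodD sJ (inKidealM (zvar k j) IH) (zvar_uspan j (drop_word a (basisv fset0))).
by congr (inKideal q _): h; rewrite mulrBr addrA subrK.
Qed.

(** [straightenK] yields an expansion, and applying [straighten] to an arbitrary one shows that its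
    coefficients are those of [straighten f]. *)
Lemma weak_interval_straighten f :
  supported is_interval (straighten f) -> weak_interval q f.
Proof.
move=> sf.
(* No set containing [0] survives a drop; this supplies the [pos_set] condition. *)
have pos : supported (fun I => 0%N \notin I) (straighten f).
  rewrite [f]malg_sum straighten_sum.
  apply: (submod_sum (supported_submod _)) => m _; rewrite straightenZ.
  apply: (submodZ (supported_submod _)); rewrite /straighten lextU.
  elim: (monom_word m) => [|j a IH] /=; first exact: supported_basisv.
  by apply: drop_supported IH => I _ J /drop_basis_supported[x []].
split.
  exists (monalg.msupp (straighten f)), (fun I => monalg.mcoeff I (straighten f)).
  split; [exact: fset_uniq | | exact: straightenK].
  by move=> I /pos h i iI; rewrite lt0n; apply: contraNneq h => <-.
move=> S a [uS posS] /straighten_inKideal h I IS aI; apply: sf.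
move/eqP: h; rewrite straightenB subr_eq0 => /eqP ->.
rewrite straighten_sum -monalg.mcoeff_neq0.
have -> : monalg.mcoeff I (\sum_(J <- S) straighten (a J *: uI k J) : {malg k[{fset nat}]}) = a I.
  rewrite raddf_sum (bigD1_seq I) //= big1_seq ?addr0 => [|J /andP[JI JS]].
    rewrite straightenZ straighten_uI /basisv ifN; last by apply/negP => /(posS _ IS).
    by rewrite monalg.mcoeffZ monalg.mcoeffUU mulr1.
  rewrite straightenZ straighten_uI /basisv monalg.mcoeffZ.
  by case: ifP => _; rewrite ?monalg.mcoeff0 ?monalg.mcoeffU ?(negbTE JI) mulr0.
by [].
Qed.

End Operators.

(** * Quasi-Lukasiewicz words *)

(** The quasi-Lukasiewicz condition on the multiset of letters, without [m_c] and [M_c]: [i] runs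
    over all right ends of runs of letters, the least of which is [m_c], and [l] over all letters,
    the largest of which is [M_c]. *)
Definition qluk_word (a : seq nat) : Prop := a <> [::] /\
  forall i j l, (0 < i <= j)%N -> (j <= l)%N -> i \in a -> i.+1 \notin a -> l \in a ->
    (j <= count (leq^~ j) a)%N.

Lemma qluk_word_perm a b : perm_eq a b -> qluk_word a -> qluk_word b.
Proof.
move=> h [a0 ha]; split.
  by move=> b0; apply: a0; apply: perm_nilP; rewrite -b0.
by move=> i j l; rewrite -!(perm_mem h) -(seq.permP h); exact: ha.
Qed.

Lemma count_leqS (a : seq nat) j :
  count (leq^~ j.+1) a = (count (leq^~ j) a + count_mem j.+1 a)%N.
Proof. by elim: a => //= x a ->; lia. Qed.

Lemma sum_count_mem (a : seq nat) j : count_mem 0%N a = 0%N ->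
  (\sum_(1 <= i < j.+1) count_mem i a = count (leq^~ j) a)%N.
Proof.
move=> a0; elim: j => [|j IH].
  by rewrite big_geq // -[LHS]a0; apply: eq_count => -[].
by rewrite big_nat_recr //= IH count_leqS.
Qed.

Lemma qluk_word_quasiLuk c a : (forall j, nth 0%N c j = count_mem j.+1 a) ->
  count_mem 0%N a = 0%N -> quasiLuk c -> qluk_word a.
Proof.
move=> ca a0 [/(has_nthP 0%N)[p hp cp] hc]; split.
  by move=> e; move: cp; rewrite ca e.
have ccE j : (0 < j)%N -> cc c j = count_mem j a by case: j => // j _; rewrite /cc /= ca.
have szE j : (0 < j)%N -> j \in a -> (j.-1 < size c)%N.
  case: j => // j _ ja; rewrite ltnNge; apply/negP => h.
  by move: ja; rewrite -has_pred1 has_count -ca nth_default.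
move=> i j l /andP[i0 ij] jl ia iNa la.
have l0 : (0 < l)%N by lia.
have -> : count (leq^~ j) a = (\sum_(1 <= i < j.+1) cc c i)%N.
  by rewrite -sum_count_mem // !big_nat; apply: eq_bigr => x /andP[x0 _]; rewrite ccE.
apply: hc; apply/andP; split.
  (* The index [i] passes the test that [m_c] searches for, so [m_c] is at most [i]. *)
  apply: leq_trans ij; rewrite /m_c.
  have iE : i = nth 0%N (iota 1 (size c)) i.-1 by rewrite nth_iota ?szE //; lia.
  rewrite -(prednK i0) ltnS leqNgt; apply/negP => h.
  have := before_find 0%N h; rewrite -iE !ccE // -has_count has_pred1 ia /=.
  by rewrite -leqn0 leqNgt -has_count has_pred1 iNa.
rewrite /M_c; have hl := szE _ l0 la.
apply: leq_trans jl _; rewrite -(prednK l0).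
apply: (leq_bigmax_cond (Ordinal hl) (F := fun o : 'I_(size c) => (nat_of_ord o).+1)).
by rewrite /= ca prednK // -has_count has_pred1.
Qed.

Lemma is_interval_fset1U x (I : {fset nat}) : is_interval I ->
  (I = fset0 \/ x.+1 \in I \/ exists2 y, x = y.+1 & y \in I) -> is_interval (x |` I).
Proof.
move=> hI hx i j l; rewrite !in_fset1U.
have [->|jx] := eqVneq j x; first by [].
case: hx => [->|hx] /=.
  by rewrite !in_fset0 !orbF => /eqP -> /eqP ->; lia.
move=> /orP[/eqP ->|iI] /orP[/eqP ->|lI] hj; try lia.
- case: hx => [xI|[y e yI]]; first by apply: hI xI lI _; lia.
  by apply: hI yI lI _; lia.
- case: hx => [xI|[y e yI]]; first by apply: hI iI xI _; lia.
  by apply: hI iI yI _; lia.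
- exact: hI iI lI hj.
Qed.

Section Words.
Variables (k : fieldType) (q : k).
Hypothesis hchar : [pchar k] =i pred0.
Hypothesis hq : forall N : nat, q ^+ N.+1 = 1 -> q = 1.

(** From an occupied site of an interval the ball stops next to it; from a free site just to the
    right it stays. Both outcomes extend the interval by one. *)
Lemma drop_basis_interval j I : is_interval I ->
  (I = fset0 \/ j \in I \/ exists2 y, j = y.+1 & y \in I) ->
  supported (fun J => is_interval J /\ exists x, [/\ x \notin I, J = x |` I & 0%N \notin J])
    (drop_basis q j I).
Proof.
move=> hI hj J /drop_basis_supported[x [xI -> J0 hx]]; split; last by exists x.
apply: is_interval_fset1U => //.
case: hj => [|hj]; first by left.
right; have [e|ne] := eqVneq x j.
  by rewrite e in xI *; case: hj => [jI|]; [rewrite jI in xI | right].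
case: hx => [[xj hy]|[xj hy]]; first by left; apply: hy; lia.
by right; exists x.-1; [lia | apply: hy; lia].
Qed.

(* Dropping the balls from left to right, each one lands next to the current interval:
   if its site j exceeds the previous site by at least 2, the quasi-Lukasiewicz
   condition at j - 1 forces the interval to reach j - 1. *)
Lemma drop_sorted_interval (a b : seq nat) :
  all (leq 1) (b ++ a) -> sorted geq (b ++ a) -> qluk_word (b ++ a) ->
  supported (fun I => [/\ is_interval I, 0%N \notin I, #|` I| = size a & {subset a <= I}])
    (drop_word q a (basisv k fset0)).
Proof.
(* [drop_word] acts from the right end of the list. The prefix [b] holds the balls still to fall, so
   that [ql] always concerns the whole word. *)
elim: a b => [|j a IH] b pos srt ql /=.
  by apply: supported_basisv => _; split.
have e : b ++ j :: a = rcons b j ++ a by rewrite cat_rcons.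
apply: drop_supported (IH (rcons b j) _ _ _); rewrite -?e // => I [hI I0 sI aI].
have aj : all (geq j) a.
  move: srt; rewrite sorted_pairwise; last by move=> x y z /=; lia.
  by rewrite pairwise_cat /= => /and3P[_ _ /andP[]].
have jb : all (leq j) b.
  move: srt; rewrite sorted_pairwise; last by move=> x y z /=; lia.
  rewrite pairwise_cat => /and3P[/allrelP h _ _].
  by apply/allP => x xb; apply: h => //; rewrite mem_head.
have j0 : (0 < j)%N by move/allP: pos; apply; rewrite mem_cat mem_head orbT.
have hj : I = fset0 \/ j \in I \/ exists2 y, j = y.+1 & y \in I.
  case: a => [|j' a] in e IH sI aI aj srt ql pos *.
    by left; apply/eqP; rewrite -cardfs_eq0 sI.
  right; have j'I := aI _ (mem_head _ _).
  have j'j : (j' <= j)%N by case/andP: aj.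
  have [ej|nej] := eqVneq j j'; first by left; rewrite ej.
  have [ej|nej1] := eqVneq j j'.+1; first by right; exists j'.
  right; exists j.-1; first by rewrite prednK.
  have le_j' : all (leq^~ j') (j' :: a).
    rewrite /= leqnn /=; move: srt; rewrite sorted_pairwise; last by move=> x1 y1 z1 /=; lia.
    by rewrite pairwise_cat /= => /and5P[].
  have j'a : j' \in b ++ j :: j' :: a by rewrite mem_cat !inE eqxx !orbT.
  have j'N : j'.+1 \notin b ++ j :: j' :: a.
    have nja : j'.+1 \notin j' :: a.
      by apply/negP => h; have := allP le_j' _ h; rewrite /= ltnn.
    have njb : j'.+1 \notin b by apply/negP => h; move: (allP jb _ h) j'j nej nej1; clear => /=; lia.
    by rewrite mem_cat in_cons (negbTE nja) (negbTE njb) orbF eq_sym.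
  have j'0 : (0 < j')%N := allP pos _ j'a.
  have j'j1 : (j' <= j.-1)%N by move: j'j nej nej1; clear; lia.
  (* [j'] occurs in the word and [j'.+1] does not, so the condition holds at [j.-1]. The letters it
     counts all lie in [a], which has as many letters as [I] has sites. *)
  have hc : (j.-1 <= #|` I|)%N.
    have := ql.2 j' j.-1 j _ (leq_pred j) j'a j'N.
    rewrite j'0 j'j1 mem_cat mem_head orbT => /(_ isT isT) /leq_trans; apply.
    have cb : count (leq^~ j.-1) b = 0%N.
      apply/eqP; rewrite -leqn0 leqNgt -has_count; apply/hasPn => x h.
      by move: (allP jb _ h) j0; clear => /=; lia.
    have cj : (j <= j.-1)%N = false by move: j0; clear; lia.
    rewrite sI count_cat cb -[j :: _]cat1s count_cat.
    rewrite [X in (_ + (X + _))%N](_ : _ = 0%N); last by rewrite /= cj.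
    exact: count_size.
  (* Otherwise [I], which avoids [0], would fit into the sites from [1] to [j - 2]. *)
  have [y yI hy] : exists2 y, y \in I & (j.-1 <= y)%N.
    apply/hasP; apply/negPn/negP => /hasPn h.
    have sub : I `<=` [fset x in iota 1 (j.-2)].
      apply/fsubsetP => x xI; rewrite in_fset /= mem_iota.
      have x0 : x != 0%N by apply: contraNneq I0 => <-.
      by move: (h _ xI) x0; clear; lia.
    have := fsubset_leq_card sub; rewrite card_fseq undup_id ?iota_uniq // size_iota.
    have : (0 < #|` I|)%N by rewrite sI.
    by move: hc j'0 j'j1; clear; lia.
  by apply: hI j'I yI _; rewrite j'j1.
move=> J JU; have jJ : j \in J.
  by move: JU; rewrite -(drop_basisv q) //; apply: supported_mem_drop.
move: JU => /(drop_basis_interval hI hj)[hJ [x [xI eJ J0]]].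
split=> //; first by rewrite eJ cardfsU1 xI sI.
move=> y; rewrite inE => /orP[/eqP ->|ya]; last by rewrite eJ in_fset1U aI ?orbT.
exact: jJ.
Qed.

Lemma drop_word_interval (a : seq nat) : all (leq 1) a -> qluk_word a ->
  supported is_interval (drop_word q a (basisv k fset0)).
Proof.
move=> pos ql; have perm_a : perm_eq a (sort geq a) by rewrite perm_sym; apply/permEl/perm_sort.
rewrite (drop_word_perm hchar hq _ perm_a) => I hI.
have [] // := @drop_sorted_interval (sort geq a) [::] _ _ _ I hI.
- by rewrite all_sort.
- by apply: sort_sorted => x y; rewrite leq_total.
- exact: qluk_word_perm perm_a ql.
Qed.
End Words.

(** * Quasisymmetric polynomials *)

Section QSym.
Variables (k : fieldType) (q : k).
Hypothesis hchar : [pchar k] =i pred0.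
Hypothesis hq : forall N : nat, q ^+ N.+1 = 1 -> q = 1.
Local Notation V := (vsets k).

Definition window (s r : nat) : {fset nat} := [fset x in iota s r].

Lemma in_window s r x : (x \in window s r) = (s <= x < s + r)%N.
Proof. by rewrite in_fset /= mem_iota. Qed.

Lemma window_interval s r : is_interval (window s r).
Proof. by move=> i j l; rewrite !in_window; lia. Qed.

(* Zero when m - b <= 0: this replaces the truncated subtraction by u_i = 0 for i <= 0. *)
Definition windowv (m b r : nat) : V :=
  if (b < m)%N then basisv k (window (m - b) r) else 0.

Lemma windowvS m b r : windowv m.+1 b.+1 r = windowv m b r.
Proof. by rewrite /windowv ltnS subSS. Qed.

Lemma windowv_supported m b r : supported is_interval (windowv m b r).
Proof.
rewrite /windowv; case: ifP => _; last exact: submod0 (supported_submod _ _).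
by apply: supported_basisv => _; exact: window_interval.
Qed.

(** The action of the image of [x_(m+1)] under [Delta_+]; for [m = 0] the second term vanishes. *)
Definition dropx (m : nat) (v : V) : V := drop q m.+1 v - drop q m v.

Lemma dropx_linear m : linear (dropx m).
Proof.
move=> a v w; rewrite /dropx !dropD !dropZ scalerBr opprD addrACA //.
Qed.
HB.instance Definition _ m := GRing.isLinear.Build k V V _ (dropx m) (dropx_linear m).

Lemma dropxZ m a v : dropx m (a *: v) = a *: dropx m v. Proof. exact: linearZ. Qed.
Lemma dropxB m v w : dropx m (v - w) = dropx m v - dropx m w. Proof. exact: linearB. Qed.

Lemma scaler_sub2 (W : lmodType k) (u v : W) (a x y : k) :
  a *: (x *: u - y *: v) = (a * x) *: u - (a * y) *: v.
Proof. by rewrite scalerBr !scalerA. Qed.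

Lemma dropx_sum m (T : Type) (r : seq T) (F : T -> V) :
  dropx m (\sum_(i <- r) F i) = \sum_(i <- r) dropx m (F i).
Proof. exact: linear_sum. Qed.

Lemma affineB (W : lmodType k) (a d : W) (x y c : k) :
  (a + (x / c) *: d) - (a + (y / c) *: d) = ((x - y) / c) *: d.
Proof. by rewrite opprD addrACA subrr add0r -scalerBl mulrBl. Qed.

(** Both [m] and [m.+1] lie between the two free neighbours [m - b] and [m - b + r.+1] of the
    window, and [qint b.+1 - qint b = q ^+ b]. The bound [b <= r] keeps [m.+1] in this range. *)
Lemma dropx_windowv m b r : (b <= r)%N -> dropx m (windowv m.+1 b r) =
  (q ^+ b / qint q r.+1) *: (windowv m.+1 b r.+1 - windowv m b r.+1).
Proof.
move=> br; have [bm|bm] := leqP b m; last first.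
  have e1 r' : windowv m.+1 b r' = 0 by rewrite /windowv ltnS leqNgt bm.
  have e2 r' : windowv m b r' = 0 by rewrite /windowv ltnNge (ltnW bm).
  by rewrite !e1 e2 subr0 [LHS]linear0 [RHS]scaler0.
have -> : windowv m.+1 b r = basisv k (window (m - b).+1 r) by rewrite /windowv ltnS bm subSn.
have -> : windowv m.+1 b r.+1 = basisv k ((m - b + r.+1)%N |` window (m - b).+1 r).
  rewrite /windowv ltnS bm subSn //; congr basisv.
  by apply/fsetP => x; rewrite in_fset1U !in_window; lia.
have -> : windowv m b r.+1 = basisv k ((m - b)%N |` window (m - b).+1 r).
  have -> : (m - b)%N |` window (m - b).+1 r = window (m - b) r.+1.
    by apply/fsetP => x; rewrite in_fset1U !in_window; lia.
  (* For [b = m] the left neighbour is the site [0], and both sides are zero. *)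
  rewrite /windowv; case: ltnP => // mb; rewrite /basisv ifT // in_window; lia.
set I := window _ r; rewrite /dropx !drop_basisv.
have h (j : nat) : (m - b <= j <= m - b + r.+1)%N -> drop_basis q j I =
  basisv k ((m - b)%N |` I) + (qint q (j - (m - b)) / qint q r.+1) *:
  (basisv k ((m - b + r.+1)%N |` I) - basisv k ((m - b)%N |` I)).
  move=> hj; rewrite (drop_basisE hchar hq hj) ?in_window ?addKn //; try lia.
  by move=> x; rewrite in_window; lia.
rewrite !h; try lia.
have -> : (m.+1 - (m - b))%N = b.+1 by lia.
have -> : (m - (m - b))%N = b by lia.
by rewrite affineB qintS [X in X / _]addrC addKr.
Qed.

(** The increment from [m] to [m.+1] of a combination of windows whose coefficients do not depend on
    [m]; sums over [m] of such terms telescope. *)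
Definition window_diff (e : nat -> k) (n m : nat) : V :=
  \sum_(b < n) e b *: (windowv m.+1 b n - windowv m b n).

Lemma sum_shift_diff (W : lmodType k) (D : nat -> W) (x y : nat -> k) n :
  \sum_(b < n) (x b *: D b - y b *: D b.+1) =
  \sum_(b < n.+1) ((if (b < n)%N then x b else 0) -
                   (if nat_of_ord b is b'.+1 then y b' else 0 : k)) *: D b.
Proof.
under [RHS]eq_bigr do rewrite scalerBl.
rewrite !sumrB [X in _ = X - _]big_ord_recr /= ltnn scale0r addr0; congr (_ - _).
  by apply: eq_bigr => b _; rewrite ltn_ord.
by rewrite big_ord_recl /= scale0r add0r.
Qed.

(** By [windowvS] both windows of a difference have the form treated by [dropx_windowv]. Each yields
    an increment of longer windows, and summation by parts collects the coefficients. *)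
Lemma dropx_window_diff n e :
  exists e', forall m, dropx m (window_diff e n m) = window_diff e' n.+1 m.
Proof.
pose c b := q ^+ b / qint q n.+1.
exists (fun b => (if (b < n)%N then e b * c b else 0) -
                 (if b is b'.+1 then e b' * c b else 0)) => m.
pose D b := windowv m.+1 b n.+1 - windowv m b n.+1.
have step b : (b < n)%N -> dropx m (e b *: (windowv m.+1 b n - windowv m b n)) =
    (e b * c b) *: D b - (e b * c b.+1) *: D b.+1.
  move=> bn; rewrite dropxZ -(windowvS m b n) dropxB.
  rewrite (dropx_windowv m (ltnW bn)) (dropx_windowv m bn).
  exact: scaler_sub2.
rewrite /window_diff [LHS]linear_sum.
rewrite (eq_bigr _ (fun (b : 'I_n) _ => step b (ltn_ord b))).
rewrite [LHS](sum_shift_diff D (fun b => e b * c b) (fun b => e b * c b.+1)).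
by apply: eq_bigr => i _; case: i => b hb; case: b hb.
Qed.

(** The exponent vectors of a monomial quasisymmetric polynomial in [m] variables. The recursion
    removes the last variable, so [al] is the composition read backwards. *)
Fixpoint qsym_exps (al : seq nat) (m : nat) : seq (seq nat) :=
  if m is m'.+1 then
    [seq rcons s 0%N | s <- qsym_exps al m'] ++
    (if al is a :: al' then [seq rcons s a | s <- qsym_exps al' m'] else [::])
  else if al is [::] then [:: [::]] else [::].

Lemma mem_qsym_exps al m s : all (leq 1) al ->
  (s \in qsym_exps al m) = (size s == m) && (rev [seq x <- s | x != 0%N] == al).
Proof.
elim: m al s => [|m IH] al s al0 /=.
  by case: al al0 => [|a al] _; case: s => [|x s] //=; rewrite in_nil.
rewrite mem_cat; case/lastP: s => [|s x].
  apply/negbTE; rewrite negb_or; apply/andP; split.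
    by apply/mapP => -[t _]; case: t.
  by case: al {al0} => // a al; apply/mapP => -[t _]; case: t.
rewrite size_rcons eqSS filter_rcons; have rI (y : nat) : injective (rcons^~ y).
  by move=> u v /rcons_inj[].
have [->|x0] := eqVneq x 0%N.
  rewrite (mem_map (rI 0%N)) IH //=.
  case: al al0 => [|a al] /= al0; first by rewrite in_nil orbF.
  rewrite [X in _ || X](_ : _ = false) ?orbF //; apply/negP => /mapP[t _ /rcons_inj[_ e]].
  by move: al0; rewrite -e.
rewrite (_ : _ \in map _ _ = false) /=; last first.
  by apply/negP => /mapP[t _ /rcons_inj[_ e]]; rewrite e in x0.
case: al al0 => [|a al] /=; first by rewrite rev_rcons andbF.
move=> /andP[a0 al0]; rewrite rev_rcons eqseq_cons.
have [->|xa] := eqVneq x a; first by rewrite (mem_map (rI a)) IH.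
rewrite andbF; apply/negP => /mapP[t _ /rcons_inj[_ e]].
by rewrite e eqxx in xa.
Qed.

Lemma qsym_exps_uniq al m : all (leq 1) al -> uniq (qsym_exps al m).
Proof.
elim: m al => [|m IH] al al0 /=; first by case: al {al0}.
have rI (y : nat) : injective (rcons^~ y) by move=> u v /rcons_inj[].
rewrite cat_uniq (map_inj_uniq (rI 0%N)) IH //=.
case: al al0 => [|a al] //= /andP[a0 al0].
rewrite (map_inj_uniq (rI a)) IH // andbT; apply/hasPn => s /mapP[t _ ->].
by apply/negP => /mapP[u _ /rcons_inj[_ e]]; rewrite e in a0.
Qed.

Definition xmonom (s : seq nat) : ZPoly k :=
  \prod_(i < size s) (zvar k i.+1 - zvar k i) ^+ nth 0%N s i.

Lemma xmonom_rcons s a :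
  xmonom (rcons s a) = (zvar k (size s).+1 - zvar k (size s)) ^+ a * xmonom s.
Proof.
rewrite /xmonom size_rcons big_ord_recr /= nth_rcons ltnn eqxx mulrC.
by congr (_ * _); apply: eq_bigr => i _; rewrite nth_rcons ltn_ord.
Qed.

Lemma straighten_xvar m f :
  straighten q ((zvar k m.+1 - zvar k m) * f) = dropx m (straighten q f).
Proof.
rewrite mulrBl straightenB; congr (_ - _); exact: straighten_zvar.
Qed.

Lemma straighten_xpow m a f :
  straighten q ((zvar k m.+1 - zvar k m) ^+ a * f) = iter a (dropx m) (straighten q f).
Proof.
elim: a => [|a IH]; first by rewrite expr0 mul1r.
by rewrite exprS -mulrA [RHS]iterS -IH; exact: straighten_xvar.
Qed.

Definition monom_qsym al m : V := \sum_(s <- qsym_exps al m) straighten q (xmonom s).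

Lemma monom_qsymS al m : all (leq 1) al -> monom_qsym al m.+1 = monom_qsym al m +
  (if al is a :: al' then iter a (dropx m) (monom_qsym al' m) else 0).
Proof.
move=> al0; rewrite [LHS]big_cat [X in X + _ = _]big_map.
have szE be t : all (leq 1) be -> t \in qsym_exps be m -> size t = m.
  by move=> be0; rewrite mem_qsym_exps // => /andP[/eqP].
have -> : \sum_(s <- qsym_exps al m) straighten q (xmonom (rcons s 0)) = monom_qsym al m.
  rewrite /monom_qsym [LHS]big_seq [RHS]big_seq; apply: eq_bigr => s /(szE _ _ al0) sm.
  by rewrite xmonom_rcons straighten_xpow.
congr (_ + _); case: al al0 {szE} (szE) => [|a al] al0 szE; first by rewrite big_nil.
have iter_sum (r : seq (seq nat)) F :
  iter a (dropx m) (\sum_(s <- r) F s) = \sum_(s <- r) iter a (dropx m) (F s).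
  by elim: a {al0} => [|a IH]; [by [] | rewrite iterS IH [LHS]linear_sum].
rewrite [RHS]iter_sum big_map [LHS]big_seq [RHS]big_seq; apply: eq_bigr => s.
by move=> /(szE _ _ (proj2 (andP al0))) sm; rewrite xmonom_rcons straighten_xpow sm.
Qed.

(** The independence of [c] from [m] is what the induction on [al] needs: only then do the
    contributions of successive [m] telescope. *)
Lemma monom_qsym_window al : all (leq 1) al ->
  (exists c : nat -> k, forall m,
    monom_qsym al m = \sum_(b < (sumn al).+1) c b *: windowv m.+1 b (sumn al)) /\
  forall m, supported is_interval (monom_qsym al m).
Proof.
elim: al => [|a al IH] al0.
  have h m : monom_qsym [::] m = basisv k fset0.
    elim: m => [|m IHm]; last by rewrite monom_qsymS // addr0.
    by rewrite /monom_qsym big_seq1 /xmonom big_ord0 straighten1.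
  split=> [|m]; last by rewrite h; apply: supported_basisv => _.
  exists (fun=> 1) => m; rewrite h big_ord1 scale1r /windowv /=; congr basisv.
  by apply/fsetP => x; rewrite in_window in_fset0; lia.
have /andP[a0 al1] := al0.
have [[c hc] _] := IH al1; set r := sumn al in hc *.
(* The part [a] is positive: the first [dropx] turns windows into increments, and the remaining ones
   preserve this shape. *)
have {hc} [e he] : exists e : nat -> k, forall m,
    iter a (dropx m) (monom_qsym al m) = window_diff e (a + r) m.
  case: a a0 {al0} => // a _; elim: a => [|a [e he]].
    exists (fun b => c b * (q ^+ b / qint q r.+1)) => m.
    rewrite iterS [iter 0 _ _]/= hc dropx_sum; apply: eq_bigr => b _.
    by rewrite dropxZ dropx_windowv ?[LHS]scalerA // -ltnS.
  have [e' he'] := dropx_window_diff (a.+1 + r) e.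
  by exists e' => m; rewrite iterS he he'.
(* Passing from [m] to [m.+1] adds exactly the increment; at [m = 0] all windows vanish. *)
have hm m : monom_qsym (a :: al) m = \sum_(b < a + r) e b *: windowv m b (a + r).
  elim: m => [|m IHm].
    by rewrite /monom_qsym big_nil big1 // => b _; rewrite /windowv ltn0 scaler0.
  rewrite monom_qsymS // he IHm /window_diff -big_split /=.
  by apply: eq_bigr => b _; rewrite -scalerDr addrC subrK.
split=> [|m]; last first.
  rewrite hm; apply: (submod_sum (supported_submod _ _)) => b _.
  by apply: (submodZ (supported_submod _ _)); exact: windowv_supported.
(* Rewriting [windowv m b] as [windowv m.+1 b.+1] shifts the coefficients by one and leaves [0] at
   [b = 0]. *)
exists (fun b => if b is b'.+1 then e b' else 0) => m /=.
rewrite hm big_ord_recl scale0r add0r; apply: eq_bigr => b _.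
by rewrite /= windowvS.
Qed.
End QSym.

(** * Quasi-Lukasiewicz monomials and quasisymmetric polynomials *)

Section Monomials.
Variables (k : fieldType) (q : k).
Hypothesis hchar : [pchar k] =i pred0.
Hypothesis hq : forall N : nat, q ^+ N.+1 = 1 -> q = 1.

Definition vector_word (c : seq nat) : seq nat :=
  flatten [seq nseq (nth 0%N c j) j.+1 | j <- iota 0 (size c)].

Lemma count_vector_word c j : count_mem j.+1 (vector_word c) = nth 0%N c j.
Proof.
rewrite /vector_word count_flatten -map_comp sumnE big_map /=.
under eq_bigr do rewrite count_nseq /= eqSS.
have [h|h] := ltnP j (size c); last first.
  rewrite nth_default // big_seq big1 // => i; rewrite mem_iota => hi.
  by rewrite (_ : (i == j) = false) ?mul0n //; lia.
rewrite (bigD1_seq j) ?mem_iota ?iota_uniq //= eqxx mul1n big1 ?addn0 // => i.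
by move=> /negbTE ->.
Qed.

Lemma vector_word_pos c : all (leq 1) (vector_word c).
Proof. by apply/allP => x /flatten_mapP[i _]; rewrite mem_nseq => /andP[_ /eqP ->]. Qed.

Lemma zpow_word c : zpow k c = \prod_(j <- vector_word c) zvar k j.
Proof.
rewrite /zpow -(big_mkord xpredT (fun j => zvar k j.+1 ^+ nth 0%N c j)).
rewrite /vector_word /index_iota subn0 big_flatten big_map; apply: eq_bigr => j _.
by rewrite big_nseq iter_mulr_1.
Qed.

Lemma supported_straighten_word a : all (leq 1) a -> qluk_word a ->
  supported is_interval (straighten q (\prod_(j <- a) zvar k j)).
Proof.
move=> a0 qa; rewrite -[\prod_(j <- a) _]mulr1 straighten_word // straighten1.
exact: drop_word_interval.
Qed.

Lemma zpow_weak_interval c : quasiLuk c -> weak_interval q (zpow k c).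
Proof.
move=> hc; apply: weak_interval_straighten => //; rewrite zpow_word.
apply: supported_straighten_word; first exact: vector_word_pos.
apply: qluk_word_quasiLuk hc => [j|]; first by rewrite count_vector_word.
apply/eqP; rewrite -leqn0 leqNgt -has_count has_pred1.
by apply/negP => /(allP (vector_word_pos c)).
Qed.

Section Quasisym.
Variable m : nat.
Implicit Types (e : mpoly.multinom m) (P : mpoly.mpoly m k).

Lemma mmap1_xmonom e :
  mpoly.mmap1 (fun i : 'I_m => zvar k i.+1 - zvar k i) e = xmonom k (tval (multinom_val e)).
Proof.
rewrite /xmonom -(big_mkord xpredT
  (fun i => (zvar k i.+1 - zvar k i) ^+ nth 0%N (tval (multinom_val e)) i)).
by rewrite size_tuple big_mkord; apply: eq_bigr => i _; rewrite (mnm_nth 0%N).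
Qed.

Lemma compoE e : compo e = [seq x <- tval (multinom_val e) | x != 0%N].
Proof.
have -> : tval (multinom_val e) = [seq e i | i <- enum 'I_m].
  apply: (@eq_from_nth _ 0%N) => [|i]; first by rewrite size_map size_enum_ord size_tuple.
  rewrite size_tuple => im.
  rewrite (nth_map (Ordinal im)) ?size_enum_ord // (mnm_nth 0%N).
  by rewrite nth_enum_ord.
by rewrite filter_map /compo.
Qed.

Lemma straighten_deltaP P : straighten q (deltaP P) =
  \sum_(e <- mpoly.msupp P) mpoly.mcoeff e P *: straighten q (xmonom k (tval (multinom_val e))).
Proof.
rewrite /deltaP /mpoly.mmap straighten_sum; apply: eq_bigr => e _.
by rewrite -scalerAl mul1r straightenZ mmap1_xmonom.
Qed.

Lemma big_partition_undup (W : nmodType) (T U : eqType) (h : T -> U) (r : seq T) (F : T -> W) :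
  \sum_(i <- r) F i = \sum_(a <- undup (map h r)) \sum_(i <- r | h i == a) F i.
Proof.
rewrite (exchange_big_dep xpredT) //= [LHS]big_seq [RHS]big_seq.
apply: eq_bigr => i ir; rewrite big_mkcond (bigD1_seq (h i)) ?undup_uniq ?eqxx //=; last first.
  by rewrite mem_undup map_f.
by rewrite big1 ?addr0 // => a; rewrite eq_sym => /negbTE ->.
Qed.

(** The monomials of [P] are grouped by composition; in each group the coefficient is constant, and
    the group is a complete monomial quasisymmetric polynomial. *)
Lemma quasisym_weak_interval P : quasisym P -> weak_interval q (deltaP P).
Proof.
move=> qP; apply: weak_interval_straighten => //; rewrite straighten_deltaP.
rewrite (big_partition_undup (@compo m)).
apply: (submod_sum (supported_submod _ _)) => al; rewrite mem_undup => /mapP[e0 e0P ale].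
have al0 : all (leq 1) (rev al).
  by rewrite all_rev ale compoE all_filter; apply/allP => -[].
rewrite big_seq_cond.
rewrite (eq_bigr (fun e => mpoly.mcoeff e0 P *: straighten q (xmonom k (tval (multinom_val e))))); last first.
  by move=> e /andP[_ /eqP h]; rewrite (qP e e0) // h.
rewrite -big_seq_cond -scaler_sumr; apply: (submodZ (supported_submod _ _)).
suff -> : \sum_(e <- mpoly.msupp P | compo e == al)
    straighten q (xmonom k (tval (multinom_val e))) = monom_qsym q (rev al) m.
  exact: (monom_qsym_window hchar hq al0).2.
rewrite -big_filter -(big_map (fun e => tval (multinom_val e)) xpredT
  (fun s => straighten q (xmonom k s))).
apply: perm_big; apply: uniq_perm.
- rewrite map_inj_uniq ?filter_uniq ?msupp_uniq // => e e' h.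
  by apply/val_inj/val_inj.
- exact: qsym_exps_uniq.
move=> s; rewrite mem_qsym_exps //; apply/mapP/andP => [[e] | [/eqP sm /eqP sal]].
  rewrite mem_filter => /andP[/eqP eal _] ->.
  by rewrite size_tuple eqxx -compoE eal.
have hs : size s == m by rewrite sm.
exists [multinom (Tuple hs)] => //.
have ea : compo [multinom (Tuple hs)] = al by rewrite compoE /= -[al]revK -sal revK.
(* The exponent does occur in [P]: its coefficient equals that of [e0], which is nonzero. *)
by rewrite mem_filter ea eqxx mcoeff_msupp (qP _ e0) -?mcoeff_msupp // ea.
Qed.
End Quasisym.
End Monomials.

(** * Divided differences in K_+ *)

Section MpolyInduction.
Variables (k : fieldType) (n : nat).
Local Notation MP := (mpoly.mpoly n k).

Lemma mpolyX_ind (P : nat -> MP -> Prop) : P 0%N 1 ->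
  (forall (i : 'I_n) m, P (mpoly.mdeg m) 'X_[m] -> P (mpoly.mdeg m).+1 ('X_i * 'X_[m])) ->
  forall m, P (mpoly.mdeg m) 'X_[m].
Proof.
move=> P1 PX m; move: {2}(mpoly.mdeg m) (leqnn (mpoly.mdeg m)) => d.
elim: d m => [|d IH] m md.
  have -> : m = 0%MM by apply/eqP; rewrite -mdeg_eq0 -leqn0.
  by rewrite mdeg0 mpolyX0.
have [->|m0] := eqVneq m 0%MM; first by rewrite mdeg0 mpolyX0.
have [i mi] : exists i, m i != 0%N.
  apply/existsP; rewrite -negb_forall; apply: contra m0 => /forallP h.
  by apply/eqP/mnmP => i; rewrite mnm0E; apply/eqP.
have e : m = (U_(i) + (m - U_(i)))%MM.
  by apply/mnmP => j; rewrite mnmDE mnmBE mnm1E; case: eqP => [<-|] /=; lia.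
rewrite e mpolyXD mdegD mdeg1 add1n; apply: PX; apply: IH.
by move: md; rewrite {1}e mdegD mdeg1.
Qed.

Lemma mpoly_alg_ind (P : MP -> Prop) : P 1 -> (forall i f, P f -> P ('X_i * f)) ->
  (forall c f g, P f -> P g -> P (c *: f + g)) -> forall f, P f.
Proof.
move=> P1 PX PL f; have P0 : P 0 by rewrite -(subrr 1) addrC -scaleN1r; apply: PL.
rewrite [f]mpolyE; elim/big_ind: _ => // [g h hg hh|m _].
  by rewrite -[g]scale1r; apply: PL.
rewrite -[_ *: _]addr0; apply: PL => //.
by apply: (mpolyX_ind (P := fun _ => P)) => // i m' hm'; apply: PX.
Qed.
End MpolyInduction.

(** * Comparing values of a polynomial at several points *)

Section Evaluation.
Variables (k : fieldType) (A : comNzRingType) (io : {rmorphism k -> A}) (n : nat).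
Implicit Types (p : 'I_n -> A) (f g : mpoly.mpoly n k).

Definition ev p : mpoly.mpoly n k -> A := mpoly.mmap io p.
HB.instance Definition _ p := GRing.RMorphism.on (ev p).

Lemma evZ p c f : ev p (c *: f) = io c * ev p f.
Proof. exact: mpoly.mmapZ. Qed.

Lemma evX p i : ev p 'X_i = p i.
Proof. by rewrite /ev mpoly.mmapX mmap1U. Qed.

Lemma ev_congr r p p' f :
  (forall i, r * (p i - p' i) = 0) -> r * (ev p f - ev p' f) = 0.
Proof.
move=> h; elim/mpoly_alg_ind: f => [|i f IH|c f g IHf IHg].
- by rewrite !rmorph1 subrr mulr0.
- rewrite !rmorphM /= !evX.
  have -> : r * (p i * ev p f - p' i * ev p' f) =
    (r * (p i - p' i)) * ev p f + p' i * (r * (ev p f - ev p' f)) by ring.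
  by rewrite h IH mul0r mulr0 addr0.
- rewrite !rmorphD /= !evZ.
  have -> : r * (io c * ev p f + ev p g - (io c * ev p' f + ev p' g)) =
    io c * (r * (ev p f - ev p' f)) + r * (ev p g - ev p' g) by ring.
  by rewrite IHf IHg mulr0 addr0.
Qed.

(** The four points form a parallelogram, and the mixed second difference of [f] lies in the ideal
    generated by products of coordinates of its two sides. *)
Lemma ev_parallel (a b c d : 'I_n -> A) f :
  (forall i, a i - b i = c i - d i) -> (forall i l, (a i - b i) * (b l - d l) = 0) ->
  ev a f - ev b f = ev c f - ev d f.
Proof.
move=> h1 h2; elim/mpoly_alg_ind: f => [|i f IH|x f g IHf IHg].
- by rewrite !rmorph1 !subrr.
- rewrite !rmorphM /= !evX; apply/eqP; rewrite -subr_eq0; apply/eqP.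
  have e1 : (a i - b i) * (ev a f - ev c f) = 0.
    apply: ev_congr => l; rewrite -[RHS](h2 i l); congr (_ * _).
    have -> : a l = c l - d l + b l by rewrite -h1 subrK.
    ring.
  have e2 : (b i - d i) * (ev a f - ev b f) = 0.
    by apply: ev_congr => l; rewrite mulrC.
  have ec : c i = a i - b i + d i by rewrite h1 subrK.
  have eC : ev c f = ev a f - ev b f + ev d f by rewrite IH subrK.
  rewrite -[RHS]addr0 -{1}e1 -e2 ec eC; ring.
- rewrite !rmorphD /= !evZ.
  have -> : io x * ev a f + ev a g - (io x * ev b f + ev b g) =
    io x * (ev a f - ev b f) + (ev a g - ev b g) by ring.
  by rewrite IHf IHg; ring.
Qed.

Lemma msym_var (s : 'S_n) i : msym s ('X_i : mpoly.mpoly n k) = 'X_(s i).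
Proof.
rewrite msymX; congr mpolyX; apply/mnmP => j.
by rewrite mnmE !mnm1E -(inj_eq (@perm_inj _ s)) permKV.
Qed.

Lemma ev_msym p (s : 'S_n) f : ev p (msym s f) = ev (fun i => p (s i)) f.
Proof.
elim/mpoly_alg_ind: f => [|i f IH|x f g IHf IHg].
- by rewrite !rmorph1.
- by rewrite !rmorphM /= msym_var IH !evX.
- by rewrite !rmorphD /= msymZ !evZ IHf IHg.
Qed.

End Evaluation.

(** Vacuous at the last index, so that it can be imposed on families indexed by all of ['I_n]. *)
Definition divdiff (k : fieldType) (n : nat) (i : 'I_n) (f g : mpoly.mpoly n k) : Prop :=
  forall hi : (i.+1 < n)%N,
    ('X_i - 'X_(Ordinal hi)) * g = f - msym (tperm i (Ordinal hi)) f.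

(** * Interpolating points and a q-analogue of Euler's identity *)

Section KlyachkoPoints.
Variables (k : fieldType) (q : k) (A : comNzRingType) (io : {rmorphism k -> A}).
Variable (u : nat -> A).
Local Notation Q := (io q).
Local Notation xv i := (u i.+1 - u i).
Hypothesis u0 : u 0%N = 0.
(** The Klyachko relation at [i.+1], up to sign: after multiplication by [u i.+1], the increment
    [xv i.+1] becomes [q] times [xv i]. *)
Hypothesis uX : forall i, u i.+1 * (xv i.+1 - Q * xv i) = 0.
Variable n : nat.
Implicit Types (f g : mpoly.mpoly n k).

(* Interpolates between (x_1, x_2, ...) at j = 0 and (q x_1, q x_2, ...); consecutive
   points differ by a transposition modulo the annihilator of u_{j+1}. *)
Definition pt (j : nat) (i : 'I_n) : A :=
  if (i < j)%N then Q * xv i else if i == j :> nat then xv i + (1 - Q) * u j else xv i.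

Lemma ev_pt_step (i : 'I_n) f g : (i.+1 < n)%N -> divdiff i f g ->
  ev io (pt i) f = ev io (pt i.+1) f + (1 - Q) * (u i.+1 * ev io (pt i.+1) g).
Proof.
move=> hi dfg; have {dfg} := dfg hi; set i' := Ordinal hi; set s := tperm i i' => dfg.
have i'i : (i' == i) = false by apply/negbTE; rewrite -val_eqE /=; lia.
(* [b] differs from [pt i.+1] only at [i'], by an element killed by [u i.+1]. The points [pt i.+1],
   [b], [pt i] and [b] composed with [s] then form a parallelogram as in [ev_parallel]. *)
pose b (l : 'I_n) := if l == i' then Q * xv i + (1 - Q) * u i.+1 else pt i.+1 l.
have bi : b i = Q * xv i by rewrite /b eq_sym i'i /pt ltnSn.
have bi' : b i' = Q * xv i + (1 - Q) * u i.+1 by rewrite /b eqxx.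
have pi' : pt i.+1 i' = xv i.+1 + (1 - Q) * u i.+1 by rewrite /pt /= ltnn eqxx.
have pl l : l != i' -> pt i.+1 l = b l by rewrite /b => /negbTE ->.
have Dp l : pt i.+1 l - b l = if l == i' then xv i.+1 - Q * xv i else 0.
  case: eqP => [->|/eqP h]; first by rewrite pi' bi'; ring.
  by rewrite pl ?subrr.
have e1 : u i.+1 * ev io (pt i.+1) g = u i.+1 * ev io b g.
  apply/eqP; rewrite -subr_eq0 -mulrBr; apply/eqP/ev_congr => l.
  by rewrite Dp; case: eqP => _; rewrite ?uX ?mulr0.
have e2 : (1 - Q) * (u i.+1 * ev io b g) = ev io (fun l => b (s l)) f - ev io b f.
  have h : (Q * xv i - (Q * xv i + (1 - Q) * u i.+1)) * ev io b g =
      ev io b f - ev io (fun l => b (s l)) f.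
    by have := congr1 (ev io b) dfg; rewrite rmorphM !rmorphB /= !evX bi bi' ev_msym.
  rewrite -[RHS]opprB -h; ring.
have e3 : ev io (pt i.+1) f - ev io b f = ev io (pt i) f - ev io (fun l => b (s l)) f.
  apply: ev_parallel => [l|l l'].
    rewrite Dp; have [->|li'] := eqVneq l i'.
      have n1 : (i' < i)%N = false by apply/negbTE; rewrite -leqNgt /=.
      have n2 : ((i' : nat) == i) = false by rewrite -i'i -val_eqE.
      by rewrite /s tpermR bi /pt n1 n2.
    have [->|li] := eqVneq l i.
      by rewrite /s tpermL bi' /pt ltnn eqxx; ring.
    rewrite /s tpermD 1?eq_sym // -pl // /pt.
    have /negbTE nli : (l : nat) != i by rewrite -val_eqE in li.
    have /negbTE nli' : (l : nat) != i.+1 by rewrite -val_eqE in li'.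
    have -> : (l < i.+1)%N = (l < i)%N by rewrite ltnS [LHS]leq_eqVlt nli.
    by rewrite nli nli' subrr.
  rewrite Dp; case: eqP => _; last by rewrite mul0r.
  have [->|li'] := eqVneq l' i'.
    rewrite /s tpermR bi bi'.
    have -> : (xv i.+1 - Q * xv i) * (Q * xv i + (1 - Q) * u i.+1 - Q * xv i) =
       (1 - Q) * (u i.+1 * (xv i.+1 - Q * xv i)) by ring.
    by rewrite uX mulr0.
  have [->|li] := eqVneq l' i.
    rewrite /s tpermL bi bi'.
    have -> : (xv i.+1 - Q * xv i) * (Q * xv i - (Q * xv i + (1 - Q) * u i.+1)) =
       - (1 - Q) * (u i.+1 * (xv i.+1 - Q * xv i)) by ring.
    by rewrite uX mulr0.
  by rewrite /s tpermD 1?eq_sym // subrr mulr0.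
rewrite e1 e2 addrC addrAC -[LHS](subrK (ev io (fun l => b (s l)) f)) -e3; ring.
Qed.

Lemma pt0 i : pt 0 i = xv i.
Proof. by rewrite /pt; case: eqP => // _; rewrite u0 mulr0 addr0. Qed.

Definition euler (d : nat) f : Prop := exists g : 'I_n -> mpoly.mpoly n k,
  (forall i, divdiff i f (g i)) /\
  \sum_(i < n | (i.+1 < n)%N) u i.+1 * ev io (pt i.+1) (g i) =
    io (qint q d) * ev io (pt 0) f.

Lemma euler_lin d c f g : euler d f -> euler d g -> euler d (c *: f + g).
Proof.
move=> [F [dF eF]] [G [dG eG]]; exists (fun i => c *: F i + G i); split.
  move=> i hi; rewrite mulrDr -scalerAr dF dG msymD msymZ scalerBr opprD addrACA //.
under eq_bigr do rewrite rmorphD /= evZ mulrDr mulrCA.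
by rewrite big_split /= -mulr_sumr eF eG rmorphD /= evZ; ring.
Qed.

Lemma euler1 : euler 0 1.
Proof.
exists (fun=> 0); split=> [i hi|]; first by rewrite msym1 subrr mulr0.
by rewrite qint0 rmorph0 mul0r big1 // => i _; rewrite rmorph0 mulr0.
Qed.

Lemma ev_pt_telescope (i : 'I_n) f (g : 'I_n -> mpoly.mpoly n k) :
  (forall i, divdiff i f (g i)) ->
  (1 - Q) * \sum_(l < n | (l < i)%N) u l.+1 * ev io (pt l.+1) (g l) =
  ev io (pt 0) f - ev io (pt i) f.
Proof.
move=> dg; rewrite mulr_sumr.
rewrite (eq_bigr (fun l : 'I_n => ev io (pt l) f - ev io (pt l.+1) f)); last first.
  move=> l li; have hl : (l.+1 < n)%N := leq_ltn_trans li (ltn_ord i).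
  apply/eqP; rewrite eq_sym subr_eq [X in _ == X]addrC; apply/eqP.
  exact: ev_pt_step.
rewrite -(big_ord_widen n (fun l => ev io (pt l) f - ev io (pt l.+1) f)) ?(ltnW (ltn_ord i)) //.
rewrite -(big_mkord xpredT (fun l => ev io (pt l) f - ev io (pt l.+1) f)).
under eq_bigr do rewrite -opprB.
by rewrite sumrN telescope_sumr // opprB.
Qed.

Lemma eulerX d (i : 'I_n) f : (i.+1 < n)%N -> euler d f -> euler d.+1 ('X_i * f).
Proof.
move=> hi [g [dg eg]].
(* The twisted Leibniz rule for the divided differences of ['X_i * f]; only the two indices adjacent
   to ['X_i] give an extra term [f] or [- f]. *)
pose G (l : 'I_n) := if l == i then f + 'X_(Ordinal hi) * g l
  else if l.+1 == i :> nat then - f + 'X_l * g l else 'X_i * g l.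
exists G; split.
  move=> l hl; have := dg l hl; rewrite msymM msym_var.
  set l' := Ordinal hl; set s := tperm l l' => h.
  rewrite /G; have [e|ne] := eqVneq l i.
    subst l; have -> : Ordinal hi = l' by apply: val_inj.
    rewrite {1}/s tpermL; rewrite -[msym s f](subKr f) -h; ring.
  case: eqP => [e|/eqP ne'].
    have e' : i = l' by apply: val_inj.
    rewrite e' /s tpermR -[msym _ f](subKr f) -h; ring.
  rewrite /s tpermD //.
  rewrite mulrCA h; ring.
set t := fun l : 'I_n => u l.+1 * ev io (pt l.+1) (g l).
set E := ev io (pt i) f.
(* A common part with factor [Q], a correction for [l < i] that telescopes, and boundary terms at
   [l = i] and [l.+1 = i]. The latter add up to [xv i * E] and cancel the end of the telescope. *)
have term (l : 'I_n) : (l.+1 < n)%N -> u l.+1 * ev io (pt l.+1) (G l) =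
    xv i * (Q * t l) + (if (l < i)%N then xv i * ((1 - Q) * t l) else 0) +
    ((if l == i then u i.+1 * E else 0) - (if l.+1 == i :> nat then u i * E else 0)).
  move=> hl; rewrite /G; have [e|ne] := eqVneq l i.
    rewrite e ltnn (_ : (i.+1 == i)%N = false); last by lia.
    have pi' : pt i.+1 (Ordinal hi) = xv i.+1 + (1 - Q) * u i.+1 by rewrite /pt /= ltnn eqxx.
    rewrite rmorphD rmorphM /= evX pi' /E (ev_pt_step hi (dg i)) /t.
    set EE := ev _ _ (g i); set EF := ev _ _ f.
    have -> : u i.+1 * (EF + (xv i.+1 + (1 - Q) * u i.+1) * EE) =
      u i.+1 * (xv i.+1 - Q * xv i) * EE + (u i.+1 * Q * xv i * EE + u i.+1 * (EF + (1 - Q) * (u i.+1 * EE))) by ring.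
    rewrite uX; ring.
  case: eqP => [e|/eqP ne'].
    have pl : pt l.+1 l = Q * xv l by rewrite /pt ltnSn.
    rewrite -e ltnSn rmorphD rmorphN rmorphM /= evX pl /t /E -e.
    set EE := ev _ _ (g l); set EF := ev _ _ f.
    have -> : u l.+1 * (- EF + Q * xv l * EE) =
      - (u l.+1 * (xv l.+1 - Q * xv l)) * EE + (u l.+1 * xv l.+1 * EE - u l.+1 * EF) by ring.
    rewrite uX; ring.
  rewrite rmorphM /= evX /t subr0 addr0.
  have [li|il] := ltnP l i.
    have -> : pt l.+1 i = xv i.
      rewrite /pt ltnS leqNgt li /= eq_sym (negbTE ne') //.
    ring.
  have -> : pt l.+1 i = Q * xv i by rewrite /pt ltnS il.
  ring.
have sum_t : \sum_(l < n | (l < i)%N) xv i * ((1 - Q) * t l) = xv i * (ev io (pt 0) f - E).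
  by rewrite -!mulr_sumr -(ev_pt_telescope i dg).
have sum_Qt : \sum_(l < n | (l.+1 < n)%N) xv i * (Q * t l) =
    xv i * (Q * (io (qint q d) * ev io (pt 0) f)) by rewrite -!mulr_sumr -eg.
rewrite (eq_bigr _ term) !big_split /= sumrN sum_Qt.
have sub (P : pred 'I_n) (F : 'I_n -> A) : (forall l, P l -> (l.+1 < n)%N) ->
    \sum_(l < n | (l.+1 < n)%N) (if P l then F l else 0) = \sum_(l < n | P l) F l.
  move=> hP; rewrite -big_mkcondr; apply: eq_bigl => l.
  by apply/andP/idP => [[]|h] //; split=> //; apply: hP.
rewrite (sub (fun l => (l < i)%N)); last by move=> l li; exact: leq_ltn_trans li (ltn_ord i).
rewrite sum_t (sub (fun l => l == i) (fun=> u i.+1 * E)); last first.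
  by move=> l /eqP ->.
rewrite big_pred1_eq (sub (fun l : 'I_n => l.+1 == i :> nat) (fun=> u i * E)); last first.
  by move=> l /eqP ->.
have -> : \sum_(l < n | l.+1 == i :> nat) u i * E = u i * E.
  (* For [i = 0] the sum is empty, in agreement with [u 0 = 0]. *)
  case: (posnP i) => [i0|i0]; first by rewrite i0 u0 mul0r big1.
  have hp : (i.-1 < n)%N by apply: leq_ltn_trans (leq_pred i) (ltn_ord i).
  rewrite (big_pred1 (Ordinal hp)) // => l /=.
  by rewrite -val_eqE /= -{1}(prednK i0) eqSS.
rewrite -/E rmorphM /= evX pt0 qintSl rmorphD rmorph1 rmorphM /=; ring.
Qed.

Lemma ev_pt_last f : (forall m, m \in mpoly.msupp f -> forall i : 'I_n, i.+1 = n -> m i = 0%N) ->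
  ev io (pt n.-1) f = ev io (fun i => Q * xv i) f.
Proof.
move=> h; rewrite /ev /mpoly.mmap !big_seq; apply: eq_bigr => m /h hm.
congr (_ * _); rewrite /mmap1; apply: eq_bigr => i _.
have [e|ne] := eqVneq i.+1 n; first by rewrite hm // !expr0.
by rewrite /pt (_ : (i < n.-1)%N) //; have := ltn_ord i; lia.
Qed.

Lemma ev_scale d f : (forall m, m \in mpoly.msupp f -> mpoly.mdeg m = d) ->
  ev io (fun i => Q * xv i) f = Q ^+ d * ev io (pt 0) f.
Proof.
move=> h; rewrite /ev /mpoly.mmap mulr_sumr !big_seq; apply: eq_bigr => m /h <-.
rewrite mulrCA; congr (_ * _); rewrite /mmap1 mdegE.
rewrite -prodrXr -big_split /=; apply: eq_bigr => i _.
by rewrite pt0 exprMn.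
Qed.
End KlyachkoPoints.

(** * Inversions and descent words *)

(** The two words have the same letters, and their counts differ only at the threshold [p.+1], by
    one. *)
Lemma qluk_word_braid p (t : seq nat) :
  qluk_word [:: p.+1, p.+1, p.+2 & t] <-> qluk_word [:: p.+1, p.+2, p.+2 & t].
Proof.
have mem x : (x \in [:: p.+1, p.+1, p.+2 & t]) = (x \in [:: p.+1, p.+2, p.+2 & t]).
  by rewrite !inE; case: (x == p.+1); case: (x == p.+2).
have cmono j : (count (leq^~ j) t <= count (leq^~ j.+1) t)%N by rewrite count_leqS leq_addr.
split=> -[_ h]; split=> // i j l ij jl.
  rewrite -!mem => ia iNa la; have hj := h i j l ij jl ia iNa la.
  (* At [j = p.+1] the count drops by one. Since [p.+2] occurs, [i] is at most [p]; the condition at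
     [p] and the remaining letter [p.+1] make up for the loss. *)
  have [jp|jp] := eqVneq j p.+1; last by move: hj jp; rewrite /=; clear; lia.
  have ip : i != p.+1 by apply: contraNneq iNa => ->; rewrite !inE eqxx !orbT.
  have ip' : (0 < i <= p)%N by move: ip ij; rewrite jp; clear; lia.
  have pl : (p <= l)%N by move: jl; rewrite jp; clear; lia.
  have := h i p l ip' pl ia iNa la; rewrite jp /=; move: (cmono p); clear; lia.
rewrite !mem => ia iNa la; have := h i j l ij jl ia iNa la.
by rewrite /=; clear; lia.
Qed.

(** The arbitrary prefix makes the relation a congruence for adding letters in front. *)
Definition qluk_equiv (a b : seq nat) : Prop :=
  forall s, qluk_word (s ++ a) <-> qluk_word (s ++ b).

Lemma qluk_equiv_cons x a b : qluk_equiv a b -> qluk_equiv (x :: a) (x :: b).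
Proof. by move=> h s; rewrite -!cat_rcons. Qed.

Lemma qluk_equiv_perm a b : perm_eq a b -> qluk_equiv a b.
Proof.
by move=> h s; split; apply: qluk_word_perm; rewrite perm_cat2l // perm_sym.
Qed.

Lemma qluk_equiv_trans a b c : qluk_equiv a b -> qluk_equiv b c -> qluk_equiv a c.
Proof. by move=> h h' s; rewrite h. Qed.

Lemma qluk_equiv_sym a b : qluk_equiv a b -> qluk_equiv b a.
Proof. by move=> h s; rewrite h. Qed.

Lemma qluk_equiv_braid p c :
  qluk_equiv [:: p.+1, p.+2, p.+1 & c] [:: p.+2, p.+1, p.+2 & c].
Proof.
move=> s.
have e1 : perm_eq (s ++ [:: p.+1, p.+2, p.+1 & c]) [:: p.+1, p.+1, p.+2 & s ++ c].
  by apply/seq.permP => x; rewrite count_cat /= count_cat; lia.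
have e2 : perm_eq (s ++ [:: p.+2, p.+1, p.+2 & c]) [:: p.+1, p.+2, p.+2 & s ++ c].
  by apply/seq.permP => x; rewrite count_cat /= count_cat; lia.
split=> h.
  apply: (qluk_word_perm (a := [:: p.+1, p.+2, p.+2 & s ++ c])); first by rewrite perm_sym.
  by apply/qluk_word_braid; apply: qluk_word_perm h.
apply: (qluk_word_perm (a := [:: p.+1, p.+1, p.+2 & s ++ c])); first by rewrite perm_sym.
by apply/qluk_word_braid; apply: qluk_word_perm h.
Qed.

(** * Descents and the word property of the symmetric group *)

Section Descents.
Variable n : nat.
Implicit Types (w v : 'S_n) (i j : 'I_n).

Definition inv w : nat := (\sum_(p : 'I_n * 'I_n | (p.1 < p.2)%N) (w p.2 < w p.1))%N.

(** The adjacent transposition permutes the ordered pairs of positions other than [(i, i')], so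
    exactly this one inversion is lost. *)
Lemma inv_descent w i (hi : (i.+1 < n)%N) : (w (Ordinal hi) < w i)%N ->
  inv w = (inv (tperm i (Ordinal hi) * w)%g).+1.
Proof.
set i' := Ordinal hi; set s := tperm i i' => hw.
have ss x : s (s x) = x by rewrite /s tpermK.
have i'E : (i' : nat) = i.+1 by [].
have -> : inv (s * w)%g = (\sum_(p : 'I_n * 'I_n | (s p.1 < s p.2)%N) (w p.2 < w p.1))%N.
  rewrite /inv (reindex_inj (h := fun p => (s p.1, s p.2))); last first.
    by apply: inv_inj => -[x y] /=; rewrite !ss.
  by apply: eq_bigr => p _; rewrite !permM !ss.
rewrite /inv (bigD1 (i, i')) /= ?i'E ?ltnSn // hw add1n; congr _.+1.
rewrite [RHS](bigD1 (i', i)) /=; last by rewrite /s tpermL tpermR i'E ltnSn.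
rewrite (_ : (w i < w i')%N = false) ?add0n; last by move: hw; clear; lia.
apply: eq_bigl => -[x y] /=; rewrite !xpair_eqE.
rewrite -!(inj_eq val_inj) /=.
rewrite /s; case: tpermP => [->|->|/eqP xi /eqP xi']; case: tpermP => [->|->|/eqP yi /eqP yi'];
  rewrite /= ?i'E; try (move: xi xi'; rewrite -!(inj_eq val_inj) /=);
  try (move: yi yi'; rewrite -!(inj_eq val_inj) /=); clear; lia.
Qed.

Lemma inv_ascent w i (hi : (i.+1 < n)%N) : (w i < w (Ordinal hi))%N ->
  inv (tperm i (Ordinal hi) * w)%g = (inv w).+1.
Proof.
move=> h; rewrite (@inv_descent _ i hi); last by rewrite !permM tpermL tpermR.
by rewrite mulgA tperm2 mul1g.
Qed.

Lemma ascent_or_descent w i (hi : (i.+1 < n)%N) :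
  (w i < w (Ordinal hi))%N \/ (w (Ordinal hi) < w i)%N.
Proof.
have : w i != w (Ordinal hi) by rewrite (inj_eq perm_inj) -val_eqE /= neq_ltn ltnSn.
by rewrite -val_eqE neq_ltn => /orP[]; [left | right].
Qed.

Lemma no_descent w :
  (forall i (hi : (i.+1 < n)%N), (w i < w (Ordinal hi))%N) -> w = 1%g.
Proof.
move=> h.
have low x (hx : (x < n)%N) : (x <= w (Ordinal hx))%N.
  elim: x hx => // x IH hx; have hx' := ltnW hx.
  have := h (Ordinal hx') hx; rewrite (_ : Ordinal (hx : _) = Ordinal hx) //.
  by apply: leq_ltn_trans; exact: IH.
have up d x (hx : (x < n)%N) : (x + d = n.-1)%N -> (w (Ordinal hx) + d < n)%N.
  elim: d x hx => [|d IH] x hx e; first by rewrite addn0.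
  have hx' : (x.+1 < n)%N by lia.
  have := h (Ordinal hx) hx'; rewrite addnS -addSn => hl.
  have := IH x.+1 hx' _; rewrite addSnnS => /(_ e); apply: leq_ltn_trans.
  by rewrite leq_add2r.
apply/permP => -[x hx]; rewrite perm1; apply: val_inj => /=.
have := low x hx; have := @up (n.-1 - x)%N x hx; lia.
Qed.

Lemma descent_exists w : w != 1%g ->
  exists i (hi : (i.+1 < n)%N), (w (Ordinal hi) < w i)%N.
Proof.
move=> w1; have [/existsP[i /existsP[j /andP[/eqP e hj]]]|h] := boolP
  [exists i : 'I_n, exists j : 'I_n, (j == i.+1 :> nat) && (w j < w i)%N].
  have hi : (i.+1 < n)%N by rewrite -e.
  by exists i, hi; rewrite (_ : Ordinal hi = j) //; apply: val_inj.
case/eqP: w1; apply: no_descent => i hi.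
case: (ascent_or_descent w hi) => // hd; case/existsP: h; exists i.
by apply/existsP; exists (Ordinal hi); rewrite eqxx.
Qed.

Lemma ascent_exists w : w != w0 n ->
  exists i (hi : (i.+1 < n)%N), (w i < w (Ordinal hi))%N.
Proof.
move=> w1; have h1 : (w * w0 n)%g != 1%g.
  apply: contra w1 => /eqP h; apply/eqP/permP => x; rewrite permE.
  by have := congr1 (fun v : 'S_n => rev_ord (v x)) h; rewrite permM perm1 permE rev_ordK.
have [i [hi hd]] := descent_exists h1; exists i, hi.
move: hd; rewrite !permM !permE /=.
by have := ltn_ord (w i); have := ltn_ord (w (Ordinal hi)); lia.
Qed.

Lemma inv_w0 : inv (w0 n) = (\sum_(i < n) (n.-1 - i))%N.
Proof.
rewrite /inv (eq_bigr (fun=> 1%N)); last first.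
  move=> [x y] /= xy; rewrite !permE /=.
  by have := ltn_ord x; have := ltn_ord y; case: leqP => //; lia.
rewrite -(pair_big_dep xpredT (fun x y : 'I_n => (x < y)%N) (fun _ _ => 1%N)) /=.
apply: eq_bigr => i _.
rewrite -(big_geq_mkord i.+1 n xpredT (fun=> 1%N)).
by rewrite sum_nat_const_nat muln1; have := ltn_ord i; lia.
Qed.

Lemma inv_le w : (inv w <= n * n)%N.
Proof.
apply: leq_trans (_ : \sum_(p : 'I_n * 'I_n) 1 <= _)%N; last first.
  by rewrite sum1_card card_prod !card_ord.
by rewrite /inv big_mkcond; apply: leq_sum => p _; case: ifP => // _; case: (_ < _)%N.
Qed.

(* Reduced words read from the right: the first letter is a right descent. *)
Inductive descent_word : 'S_n -> seq nat -> Prop :=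
| descent_nil : descent_word 1%g [::]
| descent_cons w i (hi : (i.+1 < n)%N) a : (w (Ordinal hi) < w i)%N ->
    descent_word (tperm i (Ordinal hi) * w)%g a -> descent_word w (i.+1 :: a).

Lemma descent_wordP w a : descent_word w a -> (w = 1%g /\ a = [::]) \/
  exists i (hi : (i.+1 < n)%N) b, [/\ a = i.+1 :: b, (w (Ordinal hi) < w i)%N &
    descent_word (tperm i (Ordinal hi) * w)%g b].
Proof. by case=> [|v i hi b hd hb]; [left | right; exists i, hi, b]. Qed.

Lemma descent_word_size w a : descent_word w a -> size a = inv w.
Proof.
elim=> [|v i hi b hd _ IH]; last by rewrite /= IH -inv_descent.
rewrite /inv big1 // => p hp; rewrite !perm1.
by case: (ltngtP p.1 p.2) hp.
Qed.

Lemma descent_word_exists w : exists a, descent_word w a.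
Proof.
elim: {w}_.+1 {-2}w (ltnSn (inv w)) => // d IH w hd.
have [->|w1] := eqVneq w 1%g; first by exists [::]; constructor.
have [i [hi h]] := descent_exists w1.
have [|a ha] := IH (tperm i (Ordinal hi) * w)%g; first by rewrite -ltnS -inv_descent.
by exists (i.+1 :: a); apply: descent_cons ha.
Qed.

Lemma descent_word_pos w a : descent_word w a -> all (leq 1) a.
Proof. by elim. Qed.

Lemma descent_word_commute w i j (hi : (i.+1 < n)%N) (hj : (j.+1 < n)%N) : (i.+1 < j)%N ->
  (w (Ordinal hi) < w i)%N -> (w (Ordinal hj) < w j)%N ->
  exists c, descent_word (tperm i (Ordinal hi) * w)%g (j.+1 :: c) /\
            descent_word (tperm j (Ordinal hj) * w)%g (i.+1 :: c).
Proof.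
move=> ij di dj; set i' := Ordinal hi; set j' := Ordinal hj.
have neq (x y : 'I_n) : (x < y)%N -> (x != y) /\ (y != x).
  by move=> xy; rewrite -!(inj_eq val_inj) /=; split; lia.
have [n1 n1'] := neq i j (ltnW ij); have [n2 n2'] := neq i' j ij.
have [n3 n3'] : i != j' /\ j' != i by apply: neq => /=; lia.
have [n4 n4'] : i' != j' /\ j' != i' by apply: neq => /=; lia.
have [c hc] := descent_word_exists (tperm j j' * (tperm i i' * w))%g.
have Ji : tperm j j' i = i by apply: tpermD.
have Ji' : tperm j j' i' = i' by apply: tpermD.
have Ij : tperm i i' j = j by apply: tpermD.
have Ij' : tperm i i' j' = j' by apply: tpermD.
have comm : (tperm j j' * (tperm i i' * w))%g = (tperm i i' * (tperm j j' * w))%g.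
  apply/permP => x; rewrite !permM; congr (w _).
  have [->|xi] := eqVneq x i; first by rewrite Ji tpermL Ji'.
  have [->|xi'] := eqVneq x i'; first by rewrite Ji' tpermR Ji.
  have [->|xj] := eqVneq x j; first by rewrite Ij tpermL Ij'.
  have [->|xj'] := eqVneq x j'; first by rewrite Ij' tpermR Ij.
  have Ix : tperm i i' x = x by apply: tpermD; rewrite eq_sym.
  have Jx : tperm j j' x = x by apply: tpermD; rewrite eq_sym.
  by rewrite Jx Ix Jx.
exists c; split.
  by apply: (descent_cons (hi := hj)) => //; rewrite !permM Ij Ij'.
apply: (descent_cons (hi := hi)); last by rewrite -/i' -/j' -comm.
by rewrite !permM Ji Ji'.
Qed.

(** Two adjacent descents mean three decreasing values; [c] is a word of the permutation obtained by
    sorting all three, which both braid-related products reach. *)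
Lemma descent_word_braid w i (hi : (i.+1 < n)%N) (hj : (i.+2 < n)%N) :
  (w (Ordinal hi) < w i)%N -> (w (Ordinal hj) < w (Ordinal hi))%N ->
  exists c, descent_word (tperm i (Ordinal hi) * w)%g [:: i.+2, i.+1 & c] /\
            descent_word (tperm (Ordinal hi) (Ordinal hj) * w)%g [:: i.+1, i.+2 & c].
Proof.
move=> di dj; set y := Ordinal hi; set z := Ordinal hj.
have n1 : i != y by rewrite -(inj_eq val_inj) /=; lia.
have n2 : i != z by rewrite -(inj_eq val_inj) /=; lia.
have n3 : y != z by rewrite -(inj_eq val_inj) /=; lia.
have [c hc] := descent_word_exists (tperm i y * (tperm y z * (tperm i y * w)))%g.
have zi : tperm i y z = z by apply: tpermD.
have iz : tperm y z i = i by apply: tpermD; rewrite eq_sym.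
have iy : tperm i y i = y by exact: tpermL.
have yi : tperm i y y = i by exact: tpermR.
have yz : tperm y z y = z by exact: tpermL.
have zy : tperm y z z = y by exact: tpermR.
have braid : (tperm i y * (tperm y z * (tperm i y * w)))%g =
    (tperm y z * (tperm i y * (tperm y z * w)))%g.
  apply/permP => x; rewrite !permM; congr (w _).
  have [->|xi] := eqVneq x i; first by rewrite iy yz zi iz iy yz.
  have [->|xy] := eqVneq x y; first by rewrite yi iz iy yz zi zy.
  have [->|xz] := eqVneq x z; first by rewrite zi zy yi iz.
  have Ix : tperm i y x = x by apply: tpermD; rewrite eq_sym.
  have Jx : tperm y z x = x by apply: tpermD; rewrite eq_sym.
  by rewrite Ix Jx Ix Jx.
exists c; split.
  apply: (@descent_cons _ y hj); first by rewrite -/z !permM yi zi (ltn_trans dj di).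
  by apply: (@descent_cons _ i hi) hc; rewrite -/y -/z !permM iz yz iy zi.
apply: (@descent_cons _ i hi).
  by rewrite -/y -/z !permM iz yz (ltn_trans dj di).
apply: (@descent_cons _ y hj); last by rewrite -/y -/z -braid.
by rewrite -/y -/z !permM zi zy yi iz.
Qed.

(* Matsumoto's theorem for the congruence [qluk_equiv]. *)
Lemma descent_word_equiv w a b :
  descent_word w a -> descent_word w b -> qluk_equiv a b.
Proof.
elim: {w}_.+1 {-2}w (ltnSn (inv w)) a b => // d IH w hd a b ha hb.
(* For two different first letters, both words are compared with words that share a tail [c] and
   differ by a single braid or commutation move. *)
have key (i j : 'I_n) (hi : (i.+1 < n)%N) (hj : (j.+1 < n)%N) a' b' : (i < j)%N ->
    (w (Ordinal hi) < w i)%N -> (w (Ordinal hj) < w j)%N ->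
    descent_word (tperm i (Ordinal hi) * w)%g a' ->
    descent_word (tperm j (Ordinal hj) * w)%g b' ->
    qluk_equiv (i.+1 :: a') (j.+1 :: b').
  move=> ij di dj da db.
  have IHi := IH (tperm i (Ordinal hi) * w)%g; have IHj := IH (tperm j (Ordinal hj) * w)%g.
  rewrite -ltnS -inv_descent // in IHi; rewrite -ltnS -inv_descent // in IHj.
  have [e|ne] := eqVneq (j : nat) i.+1.
    have hz : (i.+2 < n)%N by rewrite -e.
    have ej : j = Ordinal hi by apply: val_inj.
    subst j; have eh : hj = hz by exact: bool_irrelevance.
    rewrite eh in dj db IHj *.
    have [c [c1 c2]] := descent_word_braid di dj.
    apply: qluk_equiv_trans (qluk_equiv_cons _ (IHi hd _ _ da c1)) _.
    apply: qluk_equiv_trans (qluk_equiv_braid _ _) _.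
    exact: qluk_equiv_cons (IHj hd _ _ c2 db).
  have ij' : (i.+1 < j)%N by lia.
  have [c [c1 c2]] := descent_word_commute ij' di dj.
  apply: qluk_equiv_trans (qluk_equiv_cons _ (IHi hd _ _ da c1)) _.
  apply: qluk_equiv_trans (qluk_equiv_cons _ (IHj hd _ _ c2 db)).
  apply: qluk_equiv_perm; apply/seq.permP => x /=; lia.
have [[w1 ea]|[i [hi [a' [ea di da]]]]] := descent_wordP ha.
  have := descent_word_size hb; rewrite -(descent_word_size ha) ea => /size0nil ->.
  by move=> s.
have [[w1 eb]|[j [hj [b' [eb dj db]]]]] := descent_wordP hb.
  by move: di; rewrite w1 !perm1 /= ltnNge leqnSn.
rewrite ea eb; case: (ltngtP i j) => [ij|ji|/val_inj e].
- exact: key ij di dj da db.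
- exact: qluk_equiv_sym (key _ _ _ _ _ _ ji dj di db da).
subst j; have eh : hj = hi by exact: bool_irrelevance.
rewrite eh in db; apply: qluk_equiv_cons; apply: IH da db.
by rewrite -ltnS -inv_descent.
Qed.
End Descents.

(** * Schubert polynomials *)

Section ReducedWords.
Variable n' : nat.
Local Notation n := n'.+1.
Implicit Types (w : 'S_n).

Definition word_prod (b : seq nat) : 'S_n := (\prod_(j <- b) s_ n j)%g.

Lemma s_E j : (0 < j < n)%N -> exists (i : 'I_n) (hi : (i.+1 < n)%N),
  j = i.+1 /\ s_ n j = tperm i (Ordinal hi).
Proof.
case: j => // j /= hj; have hj' : (j < n)%N := ltnW hj.
exists (Ordinal hj'), hj; split=> //; rewrite /s_ /=.
by congr tperm; apply: val_inj; rewrite /= inordK.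
Qed.

Lemma inv_word_prod b : valid_word n b -> (inv (word_prod b) <= size b)%N.
Proof.
elim: b => [|j b IH] /=.
  by rewrite /word_prod big_nil -(descent_word_size (descent_nil n)).
move=> /andP[/s_E[i [hi [_ e]]] /IH h]; rewrite /word_prod big_cons -/(word_prod b) e.
case: (ascent_or_descent (word_prod b) hi) => hd; first by rewrite inv_ascent.
by rewrite -ltnS -inv_descent //; do 2 apply: leqW.
Qed.

Lemma word_prod_descent b : valid_word n b -> inv (word_prod b) = size b ->
  descent_word (word_prod b) b.
Proof.
elim: b => [|j b IH] /=.
  by move=> _ _; rewrite /word_prod big_nil; constructor.
move=> /andP[/s_E[i [hi [ej e]]] vb]; have hb := inv_word_prod vb.
rewrite /word_prod big_cons -/(word_prod b) e ej.
have tt : (tperm i (Ordinal hi) * (tperm i (Ordinal hi) * word_prod b))%g = word_prod b.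
  by rewrite mulgA tperm2 mul1g.
case: (ascent_or_descent (word_prod b) hi) => hd eb.
  move: eb; rewrite inv_ascent // => -[eb].
  apply: (descent_cons (hi := hi)); last by rewrite tt; apply: IH.
  by rewrite !permM tpermL tpermR.
by have := inv_descent hd; rewrite eb => h; move: hb; rewrite h; clear; lia.
Qed.

Lemma descent_word_prod w b : descent_word w b -> w = word_prod b /\ valid_word n b.
Proof.
elim=> [|v i hi c hd _ [e vc]]; first by rewrite /word_prod big_nil.
split; last by rewrite /= hi.
have /s_E[i0 [hi0 [[ei] es]]] : (0 < i.+1 < n)%N by [].
have e0 : i0 = i by apply: val_inj.
subst i0; rewrite /word_prod big_cons -/(word_prod c) -e es.
by rewrite (bool_irrelevance hi0 hi) mulgA tperm2 mul1g.
Qed.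

(** Comparing [a] with the reverse of a descent word gives [size a <= inv w]; equality in
    [inv_word_prod] then makes every letter a descent. The reversal reflects the order of the
    product in [word_perm]. *)
Lemma reduced_word_descent w a : reduced_word w a -> descent_word w (rev a).
Proof.
case=> va ew hmin.
have vr : valid_word n (rev a) by rewrite /valid_word all_rev.
have [c hc] := descent_word_exists w; have [ewc vc] := descent_word_prod hc.
have ewp : w = word_prod (rev a) by [].
rewrite ewp; apply: word_prod_descent => //; apply/eqP; rewrite eqn_leq inv_word_prod //.
rewrite -ewp -(descent_word_size hc) -(size_rev c) size_rev.
by apply: hmin; rewrite ?/valid_word ?all_rev // /word_perm revK.
Qed.
End ReducedWords.

Lemma content_qluk_word (a : seq nat) : count_mem 0%N a = 0%N -> quasiLuk (content a) ->
  qluk_word a.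
Proof.
move=> a0; apply: qluk_word_quasiLuk => // j; rewrite /content.
have [h|h] := ltnP j (\max_(j <- a) j)%N.
  by rewrite (nth_map 0%N) ?size_iota // nth_iota.
rewrite nth_default ?size_map ?size_iota //; apply/esym/eqP.
rewrite -leqn0 leqNgt -has_count has_pred1; apply/negP => ja.
have : (j.+1 <= \max_(j <- a) j)%N by apply: (@leq_bigmax_seq _ a xpredT id).
by move/leq_trans => /(_ _ h); rewrite ltnn.
Qed.

Lemma quasiLuk_perm_descent n (w : 'S_n) c : quasiLuk_perm w -> descent_word w c ->
  qluk_word c.
Proof.
case: n w => [|n] w [a [ra qa]] hc.
  case: ra => va _ _; case: a va qa => [|j a]; last by rewrite /= ltn0 andbF.
  by move=> _ qa; have [] := @content_qluk_word [::] erefl qa.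
have ha := reduced_word_descent ra.
have a0 : count_mem 0%N a = 0%N.
  case: ra => /allP va _ _; apply/eqP; rewrite -leqn0 leqNgt -has_count has_pred1.
  by apply/negP => /va.
have := descent_word_equiv ha hc [::] => /= h; apply/h.
apply: (qluk_word_perm (a := a)); last exact: content_qluk_word.
by rewrite perm_sym; apply/permPl/perm_rev.
Qed.

(** * Staircase monomials and their divided differences *)

Section Staircase.
Variables (k : fieldType) (n : nat).
Local Notation MP := (mpoly.mpoly n k).
Implicit Types (f g : MP) (m : 'X_{1..n}).

(** The divisors of degree [d] of the staircase monomial [x_1^(n-1) ... x_(n-1)]. In particular the
    last variable is absent, as [ev_pt_last] and [eulerX] require. *)
Definition stair_mnm (d : nat) m : Prop := mpoly.mdeg m = d /\ forall i : 'I_n, (m i + i < n)%N.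
Definition stair (d : nat) f : Prop := forall m, m \in mpoly.msupp f -> stair_mnm d m.

Lemma stair_mnm_last m (i : 'I_n) : (forall j : 'I_n, (m j + j < n)%N) -> i.+1 = n -> m i = 0%N.
Proof. by move=> h e; have := h i; lia. Qed.

Lemma stair_lin d c f g : stair d f -> stair d g -> stair d (c *: f + g).
Proof.
move=> hf hg m /msuppD_le; rewrite mem_cat => /orP[|]; last exact: hg.
by move/msuppZ_le; exact: hf.
Qed.

Lemma stair0 d : stair d 0. Proof. by move=> m; rewrite msupp0. Qed.

Lemma stairX d m : stair_mnm d m -> stair d 'X_[m].
Proof. by move=> h m'; rewrite msuppX inE => /eqP ->. Qed.

Lemma stairN d f : stair d f -> stair d (- f).
Proof. by move=> h; rewrite -scaleN1r -[_ *: _]addr0; apply: stair_lin => //; apply: stair0. Qed.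

Lemma stair_sum d (T : Type) (r : seq T) (F : T -> MP) :
  (forall t, stair d (F t)) -> stair d (\sum_(t <- r) F t).
Proof.
move=> h; elim/big_ind: _ => //; first exact: stair0.
by move=> f g hf hg; rewrite -[f]scale1r; apply: stair_lin.
Qed.

Definition mnm2 (i i' : 'I_n) m (a b : nat) : 'X_{1..n} :=
  [multinom if j == i then a else if j == i' then b else m j | j < n].

Section Two.
Variables (i i' : 'I_n) (m : 'X_{1..n}).
Hypothesis ii' : i != i'.
Local Notation M := (mnm2 i i' m).

Lemma mnm2E a b : M a b = (M 0%N 0%N + U_(i) *+ a + U_(i') *+ b)%MM.
Proof.
apply/mnmP => j; rewrite !mnmDE !mulmnE !mnm1E !mnmE.
rewrite (eq_sym i) (eq_sym i'); have [->|ji] := eqVneq j i.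
  by rewrite (negbTE ii') /=; lia.
by case: eqP => _ /=; lia.
Qed.

Lemma mnm2X a b : 'X_[M a b] = 'X_[M 0%N 0%N] * 'X_i ^+ a * 'X_i' ^+ b :> MP.
Proof. by rewrite mnm2E !mpolyXD !mpolyXn. Qed.

Lemma mnm2_deg a b : mpoly.mdeg (M a b) = (mpoly.mdeg (M 0%N 0%N) + a + b)%N.
Proof. by rewrite mnm2E !mdegD !mdegMn !mdeg1 !mul1n. Qed.

Lemma mnm2_sym a b : msym (tperm i i') ('X_[M a b] : MP) = 'X_[M b a].
Proof.
rewrite msymX; congr mpolyX; apply/mnmP => j; rewrite tpermV !mnmE.
case: tpermP => [->|->|/eqP ji /eqP ji'].
- by rewrite (eq_sym i') (negbTE ii') !eqxx.
- by rewrite (eq_sym i') (negbTE ii') !eqxx.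
- by rewrite (negbTE ji) (negbTE ji').
Qed.

(** The quotient is a geometric sum in which both exponents stay below [a], so the staircase bounds
    persist at [i] and at [i']. *)
Lemma mnm2_divdiff d a b : (i' = i.+1 :> nat) -> (b <= a)%N -> (a + i' <= n)%N ->
  mpoly.mdeg (M a b) = d -> (forall j : 'I_n, (m j + j < n)%N) ->
  exists g : MP, ('X_i - 'X_i') * g = 'X_[M a b] - 'X_[M b a] /\ stair d.-1 g.
Proof.
move=> i'E ba an deg hm.
exists (\sum_(t < a - b) 'X_[M (a.-1 - t) (b + t)]); split.
  rewrite (eq_bigr (fun t : 'I_(a - b) => ('X_[M 0%N 0%N] * 'X_i ^+ b * 'X_i' ^+ b) *
    ('X_i ^+ ((a - b).-1 - t) * 'X_i' ^+ t))); last first.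
    move=> [t ht] _ /=; rewrite mnm2X.
    have -> : (a.-1 - t)%N = (b + ((a - b).-1 - t))%N by lia.
    by rewrite !exprD; ring.
  have ea (c : MP) : c ^+ a = c ^+ b * c ^+ (a - b) by rewrite -exprD subnKC.
  by rewrite -mulr_sumr mulrCA -subrXX (mnm2X a b) (mnm2X b a) !ea; ring.
apply: stair_sum => -[t ht]; apply: stairX; split.
  by rewrite -deg (mnm2_deg a b) (mnm2_deg (a.-1 - t) (b + t)); move: ht; clear; lia.
move=> j; rewrite mnmE /=; case: eqP => [->|_]; first by lia.
by case: eqP => [->|_]; [lia | exact: hm].
Qed.
End Two.

Lemma mnm2_id (i i' : 'I_n) m : mnm2 i i' m (m i) (m i') = m.
Proof. by apply/mnmP => j; rewrite mnmE; do 2?case: eqP => [->|_]. Qed.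

Lemma divdiff_mnm_exists d (i : 'I_n) m : stair_mnm d m ->
  exists g, divdiff i ('X_[m] : MP) g /\ stair d.-1 g.
Proof.
move=> [dm hm]; have [hi|hi] := boolP (i.+1 < n)%N; last first.
  by exists 0; split=> [hi'|]; [rewrite hi' in hi | apply: stair0].
set i' := Ordinal hi; have i'E : i' = i.+1 :> nat by [].
have ii' : i != i' by rewrite -(inj_eq val_inj) /= neq_ltn ltnSn.
have hmi := hm i; have hmi' := hm i'.
have [h|h] := leqP (m i') (m i).
  have [||g [e sg]] := @mnm2_divdiff i i' m ii' d (m i) (m i') i'E h _ _ hm.
  - by rewrite i'E; lia.
  - by rewrite mnm2_id.
  exists g; split=> // hi2; rewrite (bool_irrelevance hi2 hi) -/i' e.
  by rewrite mnm2_id -(mnm2_sym m ii') mnm2_id.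
have [||g [e sg]] := @mnm2_divdiff i i' m ii' d (m i') (m i) i'E (ltnW h) _ _ hm.
- by rewrite i'E in hmi' *; lia.
- by rewrite (mnm2_deg m ii' (m i')) addnAC -(mnm2_deg m ii' (m i)) mnm2_id.
exists (- g); split=> [hi2|]; last exact: stairN.
rewrite (bool_irrelevance hi2 hi) -/i' mulrN e opprB.
by rewrite mnm2_id -(mnm2_sym m ii') mnm2_id.
Qed.

Lemma divdiff_lin (i : 'I_n) c f f' g g' : divdiff i f g -> divdiff i f' g' ->
  divdiff i (c *: f + f') (c *: g + g').
Proof.
by move=> h h' hi; rewrite mulrDr -scalerAr h h' msymD msymZ scalerBr opprD addrACA.
Qed.

Lemma divdiff_uniq (i : 'I_n) f g g' : (i.+1 < n)%N -> divdiff i f g -> divdiff i f g' ->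
  g = g'.
Proof.
move=> hi h h'; apply: (@mulfI _ ('X_i - 'X_(Ordinal hi))); last by rewrite h h'.
apply/eqP => /(congr1 (mpoly.mcoeff U_(i)%MM)).
rewrite mpoly.mcoeffB !mpoly.mcoeffX mpoly.mcoeff0 eqxx.
have -> : (U_(Ordinal hi) == U_(i))%MM = false.
  apply/negbTE/eqP => /mnmP /(_ i); rewrite !mnm1E eqxx -(inj_eq val_inj) /=.
  by rewrite (_ : (i.+1 == i)%N = false) //; lia.
by move/eqP; rewrite subr0 oner_eq0.
Qed.

Lemma stair_divdiff d (i : 'I_n) f g : (i.+1 < n)%N -> stair d f -> divdiff i f g ->
  stair d.-1 g.
Proof.
move=> hi sf dfg.
suff [g' [h sg']] : exists g', divdiff i f g' /\ stair d.-1 g'.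
  by rewrite (divdiff_uniq hi dfg h).
rewrite [f]mpolyE; move: (sf : forall m, m \in mpoly.msupp f -> stair_mnm d m).
elim: (mpoly.msupp f) => [|m r IH] hr.
  exists 0; rewrite big_nil; split; last exact: stair0.
  by move=> h; rewrite mulr0 msym0 subr0.
have [|g1 [h1 s1]] := IH; first by move=> m' m'r; apply: hr; rewrite inE m'r orbT.
have [g2 [h2 s2]] := divdiff_mnm_exists i (hr m (mem_head _ _)).
exists (mpoly.mcoeff m f *: g2 + g1); rewrite big_cons.
by split; [apply: divdiff_lin | apply: stair_lin].
Qed.

Section Schubert.
Variables (S : 'S_n -> MP).
Hypothesis hS : schubert_family S.
Implicit Types (w : 'S_n).

Lemma schubert_divdiff w (i : 'I_n) (hi : (i.+1 < n)%N) : (w (Ordinal hi) < w i)%N ->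
  divdiff i (S w) (S (tperm i (Ordinal hi) * w)%g).
Proof. by move=> h hi2; rewrite (bool_irrelevance hi2 hi); exact: hS.2. Qed.

(** At an ascent [S w] is itself a divided difference, hence symmetric in the two variables:
    numerator and denominator both change sign under the transposition. *)
Lemma schubert_divdiff0 w (i : 'I_n) (hi : (i.+1 < n)%N) : (w i < w (Ordinal hi))%N ->
  divdiff i (S w) 0.
Proof.
move=> h hi2; rewrite (bool_irrelevance hi2 hi) mulr0.
set s := tperm i (Ordinal hi).
have : divdiff i (S (s * w)%g) (S w).
  have := @schubert_divdiff (s * w)%g i hi; rewrite mulgA tperm2 mul1g; apply.
  by rewrite !permM tpermL tpermR.
move=> /(_ hi) e.
have ne : ('X_i : MP) - 'X_(Ordinal hi) != 0.
  apply/eqP => e0; have := @divdiff_uniq i 0 0 1 hi.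
  have h0 : divdiff i (0 : MP) 0 by move=> ?; rewrite mulr0 msym0 subr0.
  have h1 : divdiff i (0 : MP) 1.
    by move=> hi3; rewrite (bool_irrelevance hi3 hi) e0 mul0r msym0 subr0.
  by move=> /(_ h0 h1) /eqP; rewrite eq_sym oner_eq0.
have e' := congr1 (msym s) e; rewrite msymM !msymB !msym_var tpermL tpermR in e'.
rewrite -msymMm tperm2 msym1m in e'.
apply/eqP; rewrite eq_sym subr_eq0; apply/eqP/(mulfI ne); rewrite e.
by rewrite -[LHS]opprB -e' -mulNr opprB.
Qed.

(** Descending induction on length from [w0], each step being a divided difference; [inv_le] makes
    [n * n - inv w] a valid measure. *)
Lemma schubert_stair w : stair (inv w) (S w).
Proof.
elim: {w}_.+1 {-2}w (ltnSn (n * n - inv w)%N) => // d IH w hd.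
have [->|ww] := eqVneq w (w0 n).
  rewrite hS.1; have -> : \prod_(i < n) ('X_i : MP) ^+ (n.-1 - i) =
      'X_[[multinom (n.-1 - i)%N | i < n]].
    by rewrite mpolyXE_id; apply: eq_bigr => i _; rewrite mnmE.
  apply: stairX; split; first by rewrite inv_w0 mdegE; apply: eq_bigr => i _; rewrite mnmE.
  by move=> i; rewrite mnmE; have := ltn_ord i; lia.
have [i [hi hlt]] := ascent_exists ww.
have hv : (w i < w (Ordinal hi))%N := hlt.
have dv : divdiff i (S (tperm i (Ordinal hi) * w)%g) (S w).
  have := @schubert_divdiff (tperm i (Ordinal hi) * w)%g i hi.
  by rewrite mulgA tperm2 mul1g; apply; rewrite !permM tpermL tpermR.
have iv := inv_ascent hlt.
have -> : inv w = (inv (tperm i (Ordinal hi) * w)%g).-1 by rewrite iv.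
apply: (stair_divdiff hi _ dv); apply: IH.
by have := inv_le (tperm i (Ordinal hi) * w)%g; rewrite iv; move: hd; clear; lia.
Qed.

End Schubert.
End Staircase.

(** * Schubert polynomials in the span of descent words *)

Section SchubertSpan.
Variables (k : fieldType) (q : k) (A : comNzRingType) (io : {rmorphism k -> A}).
Variable (u : nat -> A).
Hypothesis hchar : [pchar k] =i pred0.
Hypothesis hq : forall N : nat, q ^+ N.+1 = 1 -> q = 1.
Hypothesis u0 : u 0%N = 0.
Hypothesis uX : forall i, u i.+1 * ((u i.+2 - u i.+1) - io q * (u i.+1 - u i)) = 0.
Variables (n : nat) (S : 'S_n -> mpoly.mpoly n k).
Hypothesis hS : schubert_family S.
Local Notation MP := (mpoly.mpoly n k).
Implicit Types (w v : 'S_n).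

Lemma stair_euler d (f : MP) : stair d f -> euler q io u d f.
Proof.
move=> sf.
have eu0 : euler q io u d (0 : MP).
  exists (fun=> 0); split=> [i hi|]; first by rewrite mulr0 msym0 subr0.
  by rewrite rmorph0 mulr0 big1 // => i _; rewrite rmorph0 mulr0.
have mono (m : 'X_{1..n}) : (forall i : 'I_n, i.+1 = n -> m i = 0%N) ->
    euler q io u (mpoly.mdeg m) ('X_[m] : MP).
  pose P d' (f' : MP) := (forall m, m \in mpoly.msupp f' -> forall i : 'I_n, i.+1 = n -> m i = 0%N) ->
    euler q io u d' f'.
  move=> hm; apply: (mpolyX_ind (P := P)) => [|i m' IH|m']; last 1 first.
  - by rewrite msuppX inE => /eqP ->.
  - by move=> _; exact: euler1.
  rewrite /P -mpolyXD => h; rewrite mpolyXD.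
  have hU : (U_(i) + m')%MM \in mpoly.msupp ('X_[U_(i) + m'] : MP) by rewrite msuppX inE.
  apply: eulerX => //.
    rewrite ltn_neqAle ltn_ord andbT; apply/eqP => /(h _ hU i).
    by rewrite mnmDE mnm1E eqxx.
  apply: IH => m2; rewrite msuppX inE => /eqP -> j /(h _ hU j).
  by rewrite mnmDE => /eqP; rewrite addn_eq0 => /andP[_ /eqP].
rewrite [f]mpolyE; move: (sf : forall m, m \in mpoly.msupp f -> stair_mnm d m).
elim: (mpoly.msupp f) => [|m r IH] hr; first by rewrite big_nil.
rewrite big_cons; apply: euler_lin; last first.
  by apply: IH => m' m'r; apply: hr; rewrite inE m'r orbT.
have [<- hm] := hr m (mem_head _ _); apply: mono => i e.
exact: stair_mnm_last hm e.
Qed.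

(** [A] is only a ring, so linear subspaces are expressed through the action of [k] by [io]. *)
Definition scalar_closed (N : A -> Prop) : Prop :=
  N 0 /\ forall c x y, N x -> N y -> N (io c * x + y).

Lemma scalar_closedM N c : scalar_closed N -> scalar_closed (fun y => N (c * y)).
Proof.
move=> [N0 NL]; split=> [|a x y hx hy]; first by rewrite mulr0.
by rewrite mulrDr mulrCA; apply: NL.
Qed.

Lemma scalar_closedZ N c x : scalar_closed N -> N x -> N (io c * x).
Proof. by move=> [N0 NL] h; rewrite -[_ * _]addr0; apply: NL. Qed.

Lemma scalar_closedD N x y : scalar_closed N -> N x -> N y -> N (x + y).
Proof. by move=> [N0 NL] hx hy; rewrite -[x]mul1r -(rmorph1 io); apply: NL. Qed.

(** The span as an intersection of subspaces; pulling [N] back along a multiplication then proves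
    [in_span_cons] without naming coefficients. *)
Definition in_span (w : 'S_n) (x : A) : Prop := forall N, scalar_closed N ->
  (forall a, descent_word w a -> N (\prod_(j <- a) u j)) -> N x.

Lemma in_span_cons w (i : 'I_n) (hi : (i.+1 < n)%N) x : (w (Ordinal hi) < w i)%N ->
  in_span (tperm i (Ordinal hi) * w)%g x -> in_span w (u i.+1 * x).
Proof.
move=> hd hx N sN hN; apply: (hx (fun y => N (u i.+1 * y))); first exact: scalar_closedM.
by move=> a ha; have := hN _ (descent_cons hd ha); rewrite big_cons.
Qed.

Lemma in_span_closed w : scalar_closed (in_span w).
Proof.
split=> [N [N0 _] _|c x y hx hy N sN hN]; first exact: N0.
by apply: (proj2 sN); [apply: hx | apply: hy].
Qed.

(** At [pt n.-1] the value is a power of [q] times that at [pt 0]. Each step down to a lower point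
    adds a multiple of [u i.+1] times the value of a shorter Schubert polynomial, or nothing at an
    ascent. *)
Lemma ev_pt_in_span d : (forall v : 'S_n, (inv v <= d)%N -> in_span v (ev io (pt q io u 0) (S v))) ->
  forall j v, (inv v <= d)%N -> (j <= n.-1)%N ->
    in_span v (ev io (pt q io u (n.-1 - j)) (S v)).
Proof.
move=> IH; elim=> [|j IHj] v vd jn.
  rewrite subn0 ev_pt_last; last first.
    by move=> m /(schubert_stair hS)[_ hm] i; exact: stair_mnm_last.
  rewrite (ev_scale q io u0 (d := inv v)); last by move=> m /(schubert_stair hS)[].
  by rewrite -rmorphXn; apply: (scalar_closedZ _ (in_span_closed v)); exact: IH.
have e : (n.-1 - j)%N = (n.-1 - j.+1).+1 by lia.
have hi' : (n.-1 - j.+1 < n)%N by lia.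
pose i := Ordinal hi'; have hi : (i.+1 < n)%N by rewrite /=; lia.
have IHj1 := IHj v vd (ltnW jn); rewrite e -/(nat_of_ord i) in IHj1.
rewrite -/(nat_of_ord i); case: (ascent_or_descent v hi) => hd.
  rewrite (ev_pt_step uX hi (schubert_divdiff0 hS hd)) rmorph0 !mulr0 addr0.
  exact: IHj1.
rewrite (ev_pt_step uX hi (schubert_divdiff hS hd)).
have sp := in_span_closed v; apply: (scalar_closedD sp) => //.
rewrite -[1](rmorph1 io) -rmorphB; apply: (scalar_closedZ _ sp).
apply: (in_span_cons hd); have := IHj (tperm i (Ordinal hi) * v)%g _ (ltnW jn).
by rewrite e; apply; move: vd; rewrite (inv_descent hd); exact: ltnW.
Qed.

Lemma schubert_in_span w : in_span w (ev io (pt q io u 0) (S w)).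
Proof.
elim: {w}_.+1 {-2}w (ltnSn (inv w)) => // d IH w; rewrite ltnS => hd.
have st : stair (inv w) (S w) by apply: schubert_stair.
have [g [dg eg]] := stair_euler st.
have sp := in_span_closed w.
have [w1|w1] := eqVneq w 1%g.
  have i0 : inv w = 0%N by rewrite w1 -(descent_word_size (descent_nil n)).
  have -> : S w = (mpoly.mcoeff 0%MM (S w)) *: 1.
    rewrite [LHS]mpolyE; apply/mpolyP => m.
    rewrite -mpolyE mpoly.mcoeffZ mpoly.mcoeff1; case: eqP => [->|m0]; first by rewrite mulr1.
    rewrite mulr0; apply: memN_msupp_eq0; apply/negP => /st[]; rewrite i0 => /eqP.
    by rewrite mdeg_eq0 => /eqP.
  rewrite evZ rmorph1; apply: (scalar_closedZ _ sp) => N sN hN.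
  by have := hN [::]; rewrite big_nil; apply; rewrite w1; constructor.
have [i0 [hi0 hd0]] := descent_exists w1.
have ed : inv w = (inv w).-1.+1 by rewrite (inv_descent hd0).
(* Euler's identity: only descents contribute, each through a permutation of smaller length. The
   factor is invertible because [w] is not the identity. *)
have : in_span w (io (qint q (inv w)) * ev io (pt q io u 0) (S w)).
  rewrite -eg; elim/big_ind: _ => [|x y hx hy|i hi]; first exact: sp.1.
    exact: (scalar_closedD sp).
  case: (ascent_or_descent w hi) => hd1.
    rewrite (divdiff_uniq hi (dg i) (schubert_divdiff0 hS hd1)) rmorph0 mulr0.
    exact: sp.1.
  rewrite (divdiff_uniq hi (dg i) (schubert_divdiff hS hd1)).
  apply: (in_span_cons hd1).
  have iv := inv_descent hd1.
  have h1 := @ev_pt_in_span (inv (tperm i (Ordinal hi) * w)%g) _ (n.-1 - i.+1)%N (tperm i (Ordinal hi) * w)%g (leqnn _) (leq_subr _ _).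
  have hle : (i.+1 <= n.-1)%N by rewrite -ltnS (ltn_predK hi).
  rewrite (subKn hle) in h1.
  by apply: h1 => v hv; apply: IH; move: hd; rewrite iv; apply: leq_ltn_trans.
have /(@scalar_closedZ _ (qint q (inv w))^-1) h := sp.
move=> /h; rewrite mulrA -rmorphM mulVf ?rmorph1 ?mul1r //.
by rewrite ed; exact: qint_neq0.
Qed.
End SchubertSpan.

(** * The Klyachko algebra as a quotient ring *)

Section KlyachkoQuotient.
Variables (k : fieldType) (q : k).
Hypothesis hchar : [pchar k] =i pred0.
Hypothesis hq : forall N : nat, q ^+ N.+1 = 1 -> q = 1.

Definition straighten_ker : pred (ZPoly k) := fun f => straighten q f == 0.

Lemma straighten_ker_idealr : idealr_closed straighten_ker.
Proof.
split; first by apply/eqP; exact: straighten0.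
  apply/negP => /eqP; rewrite straighten1 /basisv in_fset0 => /malgP /(_ fset0) /eqP.
  by rewrite monalg.mcoeffUU monalg.mcoeff0 oner_eq0.
move=> a f g /eqP hf /eqP hg; apply/eqP.
by rewrite [LHS]straightenD hg addr0; exact: straighten_ideal.
Qed.

(** The evaluation arguments need a commutative ring where the Klyachko relations are equalities.
    The kernel of [straighten] is a proper ideal, and in its quotient equality means equal
    expansions. *)
Lemma klyachko_quotient : exists (A : comNzRingType) (phi : {rmorphism ZPoly k -> A}),
  (forall f g, phi f = phi g -> straighten q f = straighten q g) /\
  (forall f, straighten q f = 0 -> phi f = 0).
Proof.
pose I : idealr (ZPoly k) := HB.pack straighten_ker
  (isIdealr.Build (ZPoly k) straighten_ker straighten_ker_idealr).
pose A : comNzRingType := {ideal_quot I}.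
exists A, (GRing.RMorphism.clone _ _ (\pi_({ideal_quot I}))%qT _).
have piE0 f g : (\pi_({ideal_quot I}) f == \pi_({ideal_quot I}) g)%qT = straighten_ker (f - g).
  by rewrite -Quotient.idealrBE.
split=> [f g /eqP|f /eqP hf].
  by rewrite piE0 /straighten_ker straightenB subr_eq0 => /eqP.
apply/eqP; rewrite -[0 in X in _ == X](rmorph0 (GRing.RMorphism.clone _ _ (\pi_({ideal_quot I}))%qT _)).
by rewrite piE0 subr0.
Qed.

Section Main.
Variables (A : comNzRingType) (phi : {rmorphism ZPoly k -> A}).
Hypothesis phi_inj : forall f g, phi f = phi g -> straighten q f = straighten q g.
Hypothesis phi0 : forall f, straighten q f = 0 -> phi f = 0.

Definition scal : k -> A := phi \o (@mkmalgU {cmonom nat} k mone).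
HB.instance Definition _ := GRing.RMorphism.on scal.
Definition uvar (j : nat) : A := phi (zvar k j).

Lemma phiZ c f : phi (c *: f) = scal c * phi f.
Proof. by rewrite -monalg.mul_malgC rmorphM. Qed.

Lemma phiB f g : phi (f - g) = phi f - phi g. Proof. exact: rmorphB. Qed.

Lemma uvarM i j : phi (zvar k i * zvar k j) = uvar i * uvar j.
Proof. exact: rmorphM. Qed.

Lemma uvar_rel i :
  uvar i.+1 * ((uvar i.+2 - uvar i.+1) - scal q * (uvar i.+1 - uvar i)) = 0.
Proof.
have h : phi (klyachko_rel q i.+1) = (scal q + 1) * (uvar i.+1 * uvar i.+1) -
    scal q * (uvar i.+1 * uvar i) - uvar i.+1 * uvar i.+2.
  have sE : scal (q + 1) = scal q + 1 by rewrite rmorphD rmorph1.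
  rewrite -sE [LHS]phiB [X in X - _ = _]phiB [X in X - _ - _ = _]phiZ.
  rewrite [X in _ - X - _ = _]phiZ [X in _ * X - _ - _ = _]uvarM.
  by rewrite [X in _ - _ * X - _ = _]uvarM [X in _ - _ - X = _]uvarM.
have := etrans (esym h) (phi0 (straighten_klyachko hchar hq i.+1)); clear h.
move: (uvar i) (uvar i.+1) (uvar i.+2) (scal q) => x y z r h.
have -> : y * (z - y - r * (y - x)) = - ((r + 1) * (y * y) - r * (y * x) - y * z) by ring.
by rewrite h oppr0.
Qed.

Lemma phi_deltaP n (P : mpoly.mpoly n k) : phi (deltaP P) = ev scal (pt q scal uvar 0) P.
Proof.
rewrite /deltaP /ev /mpoly.mmap rmorph_sum; apply: eq_bigr => m _.
rewrite rmorphM phiZ rmorph1 mulr1; congr (_ * _).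
rewrite /mmap1 rmorph_prod; apply: eq_bigr => i _.
by rewrite rmorphXn rmorphB pt0 // /uvar rmorph0.
Qed.

Lemma schubert_supported n (S : 'S_n -> mpoly.mpoly n k) (w : 'S_n) :
  schubert_family S -> quasiLuk_perm w -> supported is_interval (straighten q (deltaP (S w))).
Proof.
move=> hS hw; have u0 : uvar 0 = 0 by rewrite /uvar rmorph0.
have sI := supported_submod k is_interval.
(* One representative with interval support suffices, because [straighten] factors through [phi].
   The images of such polynomials form the subspace to which [in_span] is applied. *)
have [f [ef sf]] : exists f, phi f = phi (deltaP (S w)) /\
    supported is_interval (straighten q f).
  rewrite phi_deltaP.
  apply: (schubert_in_span hchar hq u0 uvar_rel hS (w := w)
    (N := fun x => exists f, phi f = x /\ supported is_interval (straighten q f))).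
    split; first by exists 0; rewrite rmorph0 straighten0; split=> //; exact: submod0 sI.
    move=> c _ _ [f [<- sf]] [g [<- sg]]; exists (c *: f + g); split.
      by rewrite rmorphD phiZ.
    by rewrite straightenD straightenZ; apply: (proj2 sI).
  move=> a ha; exists (\prod_(j <- a) zvar k j); split; first by rewrite rmorph_prod.
  apply: supported_straighten_word => //; first exact: descent_word_pos ha.
  exact: quasiLuk_perm_descent hw ha.
by rewrite -(phi_inj ef).
Qed.
End Main.
End KlyachkoQuotient.

Theorem mainTheorem20 (k : fieldType) (q : k)
  (hchar : [pchar k] =i pred0)
  (hq : forall N : nat, q ^+ N.+1 = 1 -> q = 1) :
  (* (1) monomials z^c with c quasi-Lukasiewicz *)
  (forall c : seq nat, quasiLuk c -> weak_interval q (zpow k c)) /\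
  (* (2) Delta_+ of quasisymmetric polynomials *)
  (forall (m : nat) (P : mpoly.mpoly m k),
      (0 < m)%N -> quasisym P -> weak_interval q (deltaP P)) /\
  (* (3) Delta_+ of Schubert polynomials of quasi-Lukasiewicz permutations *)
  (forall (n : nat) (S : 'S_n -> mpoly.mpoly n k) (w : 'S_n),
      schubert_family S -> quasiLuk_perm w -> weak_interval q (deltaP (S w))).
Proof.
split; first by move=> c; exact: zpow_weak_interval.
split; first by move=> m P _; exact: quasisym_weak_interval.
move=> n S w hS hw; apply: weak_interval_straighten => //.
have [A [phi [phi_inj phi0]]] := klyachko_quotient hchar hq.
exact: (schubert_supported hchar hq phi_inj phi0).
Qed.
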